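(* Every cubic (i.e. $3$-regular) multigraph $G$ on $n$ vertices contains a spanning subgraph $H$ such that $$\left|m(H,k) - \frac{n}{4}\right|\leq 2 \quad\text{for all } 0\leq k \leq 3.$$ Moreover, there exists a linear time algorithm to find such a spanning subgraph $H$.
   Context: A multigraph may have parallel edges but has no loops. A subgraph of a multigraph is itself allowed to be a multigraph; a spanning subgraph of $G$ has vertex set $V(G)$ and its edge set is a subset of the edge (multi)set $E(G)$. For a multigraph $H$ and an integer $k\ge 0$, $m(H,k)$ denotes the number of vertices of degree $k$ in $H$. Linear time means time $O(n)$. *)

(* Defs.v *)
From HB Require Import structures.
From mathcomp Require Import all_boot all_order all_algebra.

Set Implicit Arguments.
Unset Strict Implicit.
Unset Printing Implicit Defensive.

Import Order.TTheory GRing.Theory Num.Theory.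

(* Parallel edges are distinct elements of E with the same ends; asking for
   exactly two ends excludes loops. *)
Record multigraph (V E : finType) := Multigraph {
  ends : E -> {set V};
  card_ends : forall e, #|ends e| = 2
}.

Section Multigraphs.
Variables (V E : finType).
Implicit Type G : multigraph V E.

Definition deg G (v : V) : nat := #|[set e | v \in ends G e]|.

Definition cubic G : Prop := forall v, deg G v = 3.

Definition m G (k : nat) : nat := #|[set v | deg G v == k]|.

Definition spanning_subgraph G (F : {set E}) :
    multigraph V {e : E | e \in F} :=
  @Multigraph V {e : E | e \in F} (fun e => ends G (val e))
    (fun e => card_ends G (val e)).

Definition quarter_degrees G : Prop :=
  forall k : nat, k <= 3 ->
    (`|(m G k)%:R - #|V|%:R / 4%:R| <= 2%:R :> rat)%R.

End Multigraphs.

(* The machine model is a word RAM, programmed in a structured language with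
   finitely many scalar variables and random-access arrays (both named by
   natural numbers).  Words are the naturals below a bound W: a program that
   computes a larger number is stuck.  Every operation has unit cost. *)

Inductive binop := OpAdd | OpSub | OpMul | OpDiv | OpMod | OpLeq | OpEq.

Inductive expr :=
  | Const of nat
  | Var of nat
  | Get of nat & expr
  | Op of binop & expr & expr.

Inductive cmd :=
  | Skip
  | Assign of nat & expr
  | Store of nat & expr & expr
  | Seq of cmd & cmd
  | If of expr & cmd & cmd
  | While of expr & cmd.

Record state := State {
  var : nat -> nat;
  arr : nat -> nat -> nat
}.

Definition set_var (s : state) (x v : nat) : state :=
  State (fun y => if y == x then v else var s y) (arr s).

Definition set_arr (s : state) (a i v : nat) : state :=
  State (var s)
    (fun b j => if (b == a) && (j == i) then v else arr s b j).

Definition binop_sem (o : binop) (x y : nat) : nat :=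
  match o with
  | OpAdd => x + y
  | OpSub => x - y
  | OpMul => x * y
  | OpDiv => x %/ y
  | OpMod => x %% y
  | OpLeq => x <= y
  | OpEq => x == y
  end.

Definition word (W x : nat) : option nat := if x < W then Some x else None.

Fixpoint eval (W : nat) (s : state) (e : expr) : option nat :=
  match e with
  | Const k => word W k
  | Var x => word W (var s x)
  | Get a e1 => obind (fun i => word W (arr s a i)) (eval W s e1)
  | Op o e1 e2 =>
      obind (fun x => obind (fun y => word W (binop_sem o x y)) (eval W s e2))
        (eval W s e1)
  end.

Fixpoint cost (e : expr) : nat :=
  match e with
  | Const _ | Var _ => 1
  | Get _ e1 => (cost e1).+1
  | Op _ e1 e2 => (cost e1 + cost e2).+1
  end.

(* exec W c s t s' : started in s, the command c halts in s' after t steps;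
   a test succeeds when its value is nonzero. *)
Inductive exec (W : nat) : cmd -> state -> nat -> state -> Prop :=
  | ExecSkip s : exec W Skip s 1 s
  | ExecAssign x e s v :
      eval W s e = Some v ->
      exec W (Assign x e) s (cost e).+1 (set_var s x v)
  | ExecStore a e1 e2 s i v :
      eval W s e1 = Some i -> eval W s e2 = Some v ->
      exec W (Store a e1 e2) s (cost e1 + cost e2).+1 (set_arr s a i v)
  | ExecSeq c1 c2 s t1 s1 t2 s2 :
      exec W c1 s t1 s1 -> exec W c2 s1 t2 s2 ->
      exec W (Seq c1 c2) s (t1 + t2) s2
  | ExecIfTrue b c1 c2 s v t s1 :
      eval W s b = Some v -> v != 0 -> exec W c1 s t s1 ->
      exec W (If b c1 c2) s ((cost b).+1 + t) s1
  | ExecIfFalse b c1 c2 s t s1 :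
      eval W s b = Some 0 -> exec W c2 s t s1 ->
      exec W (If b c1 c2) s ((cost b).+1 + t) s1
  | ExecWhileTrue b c s v t1 s1 t2 s2 :
      eval W s b = Some v -> v != 0 -> exec W c s t1 s1 ->
      exec W (While b c) s1 t2 s2 ->
      exec W (While b c) s ((cost b).+1 + t1 + t2) s2
  | ExecWhileFalse b c s :
      eval W s b = Some 0 -> exec W (While b c) s (cost b).+1 s.

(* Input format: variables 0 and 1 hold the numbers of vertices and edges,
   arrays 0 and 1 list the two ends of each edge, in arbitrary order; the
   rest of the memory is zero. *)
Definition edge_list (n k : nat) (G : multigraph 'I_n 'I_k) (s : state) : Prop :=
  [/\ var s 0 = n,
      var s 1 = k,
      forall x, 1 < x -> var s x = 0,
      forall e : 'I_k, ends G e = [set v : 'I_n | (v == arr s 0 e :> nat)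
                                               || (v == arr s 1 e :> nat)]
    & forall a i, (1 < a) || (k <= i) -> arr s a i = 0].

(* Output format: array 2 marks the selected edges. *)
Definition output_edges (k : nat) (s : state) : {set 'I_k} :=
  [set e : 'I_k | arr s 2 e != 0].

(* On inputs with n vertices, words have O(log n) bits (numbers below
   (n + 2) ^ K) and the running time is at most C * (n + 1). *)
Definition finds_in_linear_time (P : cmd) : Prop :=
  exists K C : nat,
    forall (n k : nat) (G : multigraph 'I_n 'I_k) (s : state),
      cubic G -> edge_list G s ->
      exists (t : nat) (s' : state),
        [/\ exec (n.+2 ^ K) P s t s',
            t <= C * n.+1
          & quarter_degrees (spanning_subgraph G (output_edges k s'))].

(* Main.v *)
From Stdlib Require Import ZArith.
Require Import Defs.
From mathcomp Require Import all_boot all_order all_algebra.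
From mathcomp Require Import zify lra.

Set Implicit Arguments.
Unset Strict Implicit.
Unset Printing Implicit Defensive.

Import Order.TTheory GRing.Theory Num.Theory.

Delimit Scope Z_scope with stdZ.

(** Let n be the number of vertices and, for a set F of edges, let m_k be the
    number of vertices of degree k in F and x_k = m_k - n/4.  A local move
    takes a vertex v and one or two edges at v, all in F or all outside F,
    whose other ends are distinct and of equal degree, and toggles these edges.
    Only v and those other ends change degree, so the new numbers m_k depend
    only on the kind of the move: the side of F, the degree of v, the degree of
    the other ends, the number of edges.

    Put (y)+ = max(0, y).  The proof rests on the potential
      4 (|x_0| - 1)+ + 4 (|x_3| - 1)+ + 3 (|x_1| - 1)+ + 3 (|x_2| - 1)+
        + 3 |x_0 + x_1|.
    If no local move lowers it, then |x_k| <= 2 for all k ([stable_balanced]).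
    Three elementary counts of the edges outside F show that certain short
    lists of kinds always contain an available move: the edges at a vertex of
    degree i <= 2 ([any_nonedge]); the edges at vertices of degree 0, which
    cannot all lead to degrees 1 and 2 if 3 m_0 > 2 m_1 + m_2
    ([top_nonedge]); and, if m_i > m_j, one edge at each vertex of degree i,
    which cannot all lead to distinct vertices of degree j
    ([pair_nonedge]).  Passing to the complement of F gives the same facts for
    the edges in F.  A purely arithmetical case distinction
    ([unbalanced_forced]) shows that as soon as some |x_k| exceeds 2, one of
    these lists consists of kinds that lower the potential.  A set F of
    minimal potential therefore proves the first half of the theorem.

    For the algorithm, start with F empty.  The potential is O(n) and drops by
    at least 1/4 with every move, so O(n) moves suffice, and each takes
    constant time once it is found.  To find them, the program keeps a log of
    vertices and, for each of the 64 kinds, a pointer into the log.  Every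
    vertex at which a move of kind t is available occurs in the log at or after
    the pointer of t.  A move at v can make new moves available only at
    vertices within distance 2 of v, so appending these (at most 13) vertices
    to the log restores that property ([is_move_far], [body_invariant]).  The
    program advances the pointer of any kind that has unread entries and would
    lower the potential, and stops when there is none; then no available move
    lowers the potential.  The log grows by 13 entries per move, hence has
    length O(n), and each pointer passes over it once ([program_linear]). *)

(** * The potential on degree counts *)

(** Throughout, the flag [s] tells whether the edges of a move lie in F, so
    that toggling them lowers the degrees, or outside F. *)
Definition shift (s : bool) (r d : nat) := if s then d - r else d + r.

(** A move of kind [(s, j, a, r)] has [r] edges with flag [s] at a vertex of
    degree [j], and their other ends have degree [a]. *)
Definition gain (s : bool) (j a r k : nat) : nat := (shift s r j == k) + r * (shift s 1 a == k).
Definition loss (j a r k : nat) : nat := (j == k) + r * (a == k).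

(** All quantities are multiplied by 4 to stay in the integers: [x k] stands
    for [4 m_k - n], and 4 is the width of the dead zone around it. The dead
    zones make room for the moves that correct one count at the expense of
    another count that is still near n/4. *)
Definition excess (x : Z) : Z := Z.max 0 (Z.abs x - 4).
Definition potential (x : nat -> Z) : Z :=
  (4 * (excess (x 0%N) + excess (x 3%N)) + 3 * (excess (x 1%N) + excess (x 2%N))
   + 3 * Z.abs (x 0%N + x 1%N))%stdZ.
Definition moved s j a r (x : nat -> Z) (k : nat) : Z :=
  (x k + 4 * (Z.of_nat (gain s j a r k) - Z.of_nat (loss j a r k)))%stdZ.

Lemma excess_lb x : (0 <= excess x /\ x - 4 <= excess x /\ - x - 4 <= excess x)%stdZ.
Proof. rewrite /excess; lia. Qed.

Lemma excess_cases x :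
  (excess x = 0 /\ -4 <= x <= 4 \/ excess x = x - 4 /\ 4 < x
   \/ excess x = - x - 4 /\ x < -4)%stdZ.
Proof. rewrite /excess; lia. Qed.

Definition lowers x s j a r := (potential (moved s j a r x) < potential x)%stdZ.

(** Complementing F exchanges the degrees [i] and [3 - i] and the two flags;
    [mirror] translates statements about edges outside F into statements
    about edges in F. *)
Definition mirror (s : bool) (i : nat) : nat := if s then 3 - i else i.

(** The three ways in which counting edges forces a potential-lowering move to
    be available; they match [any_nonedge], [top_nonedge] and
    [pair_nonedge]. *)
Variant forced (n : Z) (x : nat -> Z) : Prop :=
| ForcedAny s i of i <= 2 & (- n < x (mirror s i))%stdZ &
    (forall k, k <= 2 -> lowers x s (mirror s i) (mirror s k) 1)
| ForcedTop s of
    (2 * x (mirror s 1) + x (mirror s 2) < 3 * x (mirror s 0))%stdZ &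
    lowers x s (mirror s 0) (mirror s 0) 1
| ForcedPair s i j of i <= 2 & j <= 3 & (x (mirror s j) < x (mirror s i))%stdZ &
    (forall k, k <= 2 -> k != j -> lowers x s (mirror s i) (mirror s k) 1) &
    lowers x s (mirror s j) (mirror s i) 2.

Ltac prune := try (exfalso; lia).
Ltac split_excess y := let H := fresh in let K := fresh in
  destruct (excess_cases y) as [[H K]|[[H K]|[H K]]]; rewrite H; prune.
(* The potential is convex piecewise linear.  Hence the old value may be
   bounded below by linear functions, and only the terms of the new value need
   a case distinction. *)
Ltac decrease :=
  unfold lowers, potential, moved;
  repeat match goal with |- context [Z.of_nat ?t] =>
    let v := eval vm_compute in (Z.of_nat t) in change (Z.of_nat t) with v end;
  match goal with |- (4 * (excess ?a + excess ?d) + 3 * (excess ?b + excess ?c) + _ <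
      4 * (excess ?a' + excess ?d') + 3 * (excess ?b' + excess ?c') + _)%stdZ =>
   destruct (excess_lb a') as (?&?&?), (excess_lb b') as (?&?&?),
     (excess_lb c') as (?&?&?), (excess_lb d') as (?&?&?);
   split_excess a; split_excess b; split_excess c; split_excess d; lia
  end.

Lemma mirrorE : (((forall i, mirror false i = i) * (mirror true 0 = 3)) *
  ((mirror true 1 = 2) * (mirror true 2 = 1) * (mirror true 3 = 0)))%type.
Proof. by []. Qed.

Ltac any_move s i := apply: (@ForcedAny _ _ s i);
  [done | rewrite !mirrorE; lia | by case=> [|[|[|//]]] _; rewrite !mirrorE; decrease].
Ltac top_move s := apply: (@ForcedTop _ _ s); rewrite !mirrorE; [lia | decrease].
Ltac pair_move s i j := apply: (@ForcedPair _ _ s i j); [done | done | rewrite !mirrorE; lia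
  | by case=> [|[|[|//]]] // _ _; rewrite !mirrorE; decrease
  | rewrite !mirrorE; decrease].

Section Unbalanced.
Local Open Scope Z_scope.

(** The thresholds of the case distinction are those where a dead zone ends or
    where the inequality that makes a list of moves available starts to hold.
    Evenness of the number [2 * h] of vertices and of [m 1 + m 3] enters the
    final linear arithmetic. *)
Lemma unbalanced_forced (m x : nat -> Z) (h p : Z) :
  (forall k, x k = 4 * m k - 2 * h) ->
  m 1%N + m 3%N = 2 * p -> 0 < h ->
  x 0%N + x 1%N + x 2%N + x 3%N = 0 -> 0 <= x 0%N + x 1%N ->
  (exists2 k, (k <= 3)%N & 8 < Z.abs (x k)) -> forced (2 * h) x.
Proof.
move=> xE mp h0 sx hx [k k3 bad].
have e0 := xE 0%N; have e1 := xE 1%N; have e2 := xE 2%N; have e3 := xE 3%N.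
have {k k3}bad : 8 < Z.abs (x 0%N) \/ 8 < Z.abs (x 1%N) \/ 8 < Z.abs (x 2%N) \/ 8 < Z.abs (x 3%N).
  by case: k k3 bad => [|[|[|[|//]]]] _; intuition.
clear xE.
have [x1|x1] := Z.le_gt_cases 2 (x 1%N).
  have [x2|x2] := Z.le_gt_cases 0 (x 2%N).
    have [x02|x02] := Z.le_gt_cases (x 2%N) (x 0%N).
      any_move false 2%N.
    have [z2|z2] := Z.le_gt_cases (x 3%N) (-10).
      pair_move false 2%N 0%N.
    have [x2'|x2'] := Z.le_gt_cases 4 (x 2%N).
      pair_move true 2%N 0%N.
    have [z0|z0] := Z.le_gt_cases (-6) (x 0%N).
      pair_move false 2%N 0%N.
    any_move true 2%N.
  have [z0|z0] := Z.le_gt_cases (-8) (x 0%N).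
    have [z2|z2] := Z.le_gt_cases (x 3%N) (-2).
      have [z0'|z0'] := Z.le_gt_cases 0 (x 0%N).
        any_move false 1%N.
      pair_move false 1%N 0%N.
    have [x02|x02] := Z.lt_ge_cases (x 2%N) (x 0%N).
      top_move true.
    any_move false 1%N.
  pair_move true 2%N 1%N.
have [x2|x2] := Z.le_gt_cases 10 (x 2%N).
  pair_move false 2%N 1%N.
have [z0|z0] := Z.le_gt_cases 8 (x 0%N).
  top_move false.
have [x2'|x2'] := Z.le_gt_cases 4 (x 2%N).
  any_move false 2%N.
top_move true.
Qed.

End Unbalanced.

(** * Local moves in a cubic multigraph *)

Definition dist (a b : nat) : nat := (a - b) + (b - a).

(** The potential again, on natural numbers and with truncated subtraction: the
    form in which the program evaluates it. *)
Definition imbalance (n : nat) (c : nat -> nat) : nat :=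
  4 * ((dist (4 * c 0) n - 4) + (dist (4 * c 3) n - 4))
  + 3 * ((dist (4 * c 1) n - 4) + (dist (4 * c 2) n - 4))
  + 3 * dist (4 * (c 0 + c 1)) (2 * n).

Definition deviation (n : nat) (c : nat -> nat) (k : nat) : Z :=
  (4 * Z.of_nat (c k) - Z.of_nat n)%stdZ.

Lemma imbalanceE n c : Z.of_nat (imbalance n c) = potential (deviation n c).
Proof.
have excessE k : Z.of_nat (dist (4 * c k) n - 4) = excess (deviation n c k).
  by rewrite /dist /excess /deviation; lia.
have distE : Z.of_nat (dist (4 * (c 0 + c 1)) (2 * n)) =
    Z.abs (deviation n c 0 + deviation n c 1).
  by rewrite /dist /deviation; lia.
by rewrite /imbalance /potential -!excessE -distE; lia.
Qed.

Lemma shift0 s d : shift s 0 d = d.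
Proof. by case: s; rewrite /shift ?subn0 ?addn0. Qed.

Section Moves.
Variables (V E : finType) (G : multigraph V E).
Implicit Types (F : {set E}) (v w : V) (e : E) (es : seq E) (s : bool).

Definition star v : {set E} := [set e | v \in ends G e].
Definition degree F v : nat := #|F :&: star v|.
Definition degree_count F k : nat := #|[set v | degree F v == k]|.

Lemma deg_spanning F v : deg (spanning_subgraph G F) v = degree F v.
Proof.
rewrite /deg /degree -(card_imset _ val_inj); apply: eq_card => e.
apply/imsetP/setIP => [[e']|[eF ve]].
  by rewrite inE => h ->; split; [exact: (valP e')|rewrite inE].
by exists (Sub e eF); rewrite ?inE //= in ve *.
Qed.

Lemma m_spanning F k : m (spanning_subgraph G F) k = degree_count F k.
Proof. by apply: eq_card => v; rewrite !inE deg_spanning. Qed.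

(** The default value is never taken, as an edge has an end other than [v]. *)
Definition other_end v e : V := odflt v [pick w in ends G e :\ v].

Lemma ends_other v e : v \in ends G e -> ends G e = [set v; other_end v e] /\ other_end v e != v.
Proof.
move=> ve; have := card_ends G e; rewrite (cardsD1 v) ve add1n => -[/eqP/cards1P[w we]].
have nw : other_end v e = w.
  rewrite /other_end; case: pickP => [u|/(_ w)]; rewrite we inE; first by move/eqP.
  by rewrite eqxx.
have : w \in ends G e :\ v by rewrite we inE.
rewrite nw !inE => /andP[wv _]; split=> //.
by rewrite -(setD1K ve) we.
Qed.

Lemma other_endK v e : v \in ends G e -> other_end (other_end v e) e = v.
Proof.
move=> ve; have [ee nv] := ends_other ve.
have ne : other_end v e \in ends G e by rewrite ee !inE eqxx orbT.
have [ee' nv'] := ends_other ne.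
have : v \in ends G e by [].
by rewrite ee' !inE eq_sym (negPf nv) => /eqP.
Qed.

Lemma mem_ends v e w : v \in ends G e -> (w \in ends G e) = (w == v) || (w == other_end v e).
Proof. by move=> /ends_other[-> _]; rewrite !inE. Qed.

Lemma other_end_in v e : v \in ends G e -> other_end v e \in ends G e.
Proof. by move=> ve; rewrite (mem_ends _ ve) eqxx orbT. Qed.

(** The [uniq] condition keeps two parallel edges out of a move: they would
    change the degree of one other end by 2. *)
Definition is_move F s j a v es : bool :=
  [&& degree F v == j,
      all (fun e => [&& v \in ends G e, (e \in F) == s & degree F (other_end v e) == a]) es
    & uniq (map (other_end v) es)].

Definition toggle F es : {set E} := [set e | (e \in F) (+) (e \in es)].

Lemma degree_toggle F s j a v es w : is_move F s j a v es ->
  degree (toggle F es) w =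
    shift s (if w == v then size es else w \in map (other_end v) es) (degree F w).
Proof.
case/and3P=> _ /allP all_es uniq_nb.
have uniq_es := map_uniq uniq_nb.
have deg_es : #|[set:: es] :&: star w| = if w == v then size es else w \in map (other_end v) es.
  have -> : #|[set:: es] :&: star w| = seq.count (fun e => w \in ends G e) es.
    rewrite -size_filter -(card_uniqP (filter_uniq _ uniq_es)).
    by apply: eq_card => e; rewrite !inE mem_filter andbC.
  have [->|wv] := eqVneq w v.
    by apply/eqP; rewrite -all_count; apply/allP => e /all_es/and3P[].
  rewrite -(count_uniq_mem w uniq_nb) count_map.
  by apply: eq_in_count => e /all_es/and3P[ve _ _]; rewrite (mem_ends _ ve) (negPf wv) eq_sym.
rewrite -deg_es /degree /shift; case: s all_es => all_es.
  rewrite -(cardsID [set:: es] (F :&: star w)).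
  have -> : F :&: star w :&: [set:: es] = [set:: es] :&: star w.
    apply/setP => e; rewrite !inE andbC; case es_e: (e \in es) => //=.
    by case/and3P: (all_es e es_e) => _ /eqP-> _.
  rewrite addKn; apply: eq_card => e; rewrite !inE.
  case es_e: (e \in es); last by rewrite addbF.
  by case/and3P: (all_es e es_e) => _ /eqP-> _.
have -> : toggle F es :&: star w = (F :&: star w) :|: ([set:: es] :&: star w).
  apply/setP => e; rewrite !inE -andb_orl; congr andb.
  case es_e: (e \in es); last by rewrite addbF orbF.
  by case/and3P: (all_es e es_e) => _ /eqP-> _.
rewrite cardsU; set X := (X in _ - X); suff -> : X = 0 by rewrite subn0.
apply/eqP; rewrite cards_eq0 -subset0; apply/subsetP => e; rewrite !inE.
case es_e: (e \in es); last by rewrite /= andbF.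
by case/and3P: (all_es e es_e) => _ /eqP->.
Qed.

Lemma degree_countE F k : degree_count F k = \sum_v (degree F v == k).
Proof. by rewrite /degree_count -sum1_card big_mkcond; apply: eq_bigr => v _; rewrite inE; case: eqP. Qed.

Lemma degree_count_toggle F s j a v es k : is_move F s j a v es ->
  degree_count (toggle F es) k + loss j a (size es) k = degree_count F k + gain s j a (size es) k.
Proof.
move=> mv; case/and3P: (mv) => /eqP dv /allP all_es uniq_nb.
have sum1 (x : nat) : \sum_w (w == v) * x = x.
  by rewrite (bigD1 v) //= eqxx mul1n big1 ?addn0 // => w /negPf->.
have sumr (x : nat) : \sum_w (w \in map (other_end v) es) * x = size es * x.
  rewrite -big_distrl /= -(size_map (other_end v) es) -(card_uniqP uniq_nb) -sum1_card.
  by rewrite [in RHS]big_mkcond; congr (_ * _); apply: eq_bigr => w _; case: ifP.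
rewrite /loss /gain -(sum1 (j == k)) -(sum1 (shift s (size es) j == k)) -!sumr !degree_countE -!big_split /=.
apply: eq_bigr => w _; rewrite (degree_toggle w mv).
have [->|wv] := eqVneq w v.
  have /negPf-> : v \notin map (other_end v) es.
    apply/mapP => -[e /all_es/and3P[ve _ _] vE].
    by have [_] := ends_other ve; rewrite -vE eqxx.
  by rewrite dv !mul0n !mul1n !addn0 addnC.
rewrite !mul0n !add0n.
case: (boolP (w \in _)) => [/mapP[e /all_es/and3P[_ _ /eqP de] ->]|_].
  by rewrite de !mul1n addnC.
by rewrite shift0 !mul0n.
Qed.


(** Availability of a move at [w] depends on the edges at [w] and on the
    degrees of [w] and its neighbours, which a move at [v] leaves alone if [w]
    has distance more than 2 from [v]. *)
Lemma is_move_far F s j a v es s' j' a' w es' :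
  is_move F s j a v es -> w != v -> (forall e, v \in ends G e -> w != other_end v e) ->
  (forall e e', v \in ends G e -> other_end v e \in ends G e' -> w != other_end (other_end v e) e') ->
  is_move (toggle F es) s' j' a' w es' -> is_move F s' j' a' w es'.
Proof.
move=> mv wv far1 far2 /and3P[dw /allP all_es' uniq'].
have all_es : {in es, forall e, v \in ends G e} by case/and3P: mv => _ /allP h _ e /h /and3P[].
have same u : u != v -> u \notin map (other_end v) es -> degree (toggle F es) u = degree F u.
  by move=> /negPf uv /negPf un; rewrite (degree_toggle u mv) uv un shift0.
apply/and3P; split=> //.
  rewrite -same //; apply/mapP => -[e /all_es ve wE].
  by have := far1 e ve; rewrite wE eqxx.
apply/allP => e /all_es'/and3P[we /eqP fe /eqP de]; rewrite we /=.
have enotin : e \notin es.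
  apply/negP => /all_es ve; have := far1 e ve.
  by move: we; rewrite (mem_ends _ ve) (negPf wv) /= => /eqP->; rewrite eqxx.
move: fe; rewrite inE (negPf enotin) addbF => ->; rewrite eqxx -de -same ?eqxx //.
  apply/eqP => nv; have ve : v \in ends G e by rewrite -nv other_end_in.
  by have := far1 e ve; rewrite -nv other_endK ?eqxx.
apply/mapP => -[e1 /all_es ve1 nE].
have := far2 e1 e ve1; rewrite -nE other_end_in // => /(_ isT).
by rewrite other_endK ?eqxx.
Qed.

Lemma sum_degree F (A : {set V}) :
  \sum_(v in A) degree F v = \sum_(e in F) #|ends G e :&: A|.
Proof.
under eq_bigr => v _ do rewrite /degree -sum1_card (eq_bigl _ _ (fun e => in_setI e F (star v))).
rewrite (exchange_big_dep (mem F)) /=; last by move=> v e _ /andP[].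
apply: eq_bigr => e eF; rewrite -sum1_card; apply: eq_bigl => v.
by rewrite !inE eF /= andbC.
Qed.

Lemma handshake F : \sum_v degree F v = 2 * #|F|.
Proof.
have /= := sum_degree F [set: V]; under eq_bigl do rewrite inE.
move=> ->; rewrite mulnC -sum_nat_const; apply: eq_bigr => e _.
by rewrite setIT card_ends.
Qed.

Hypothesis cubicG : cubic G.

Lemma card_star v : #|star v| = 3. Proof. exact: cubicG. Qed.

Lemma degree_le3 F v : degree F v <= 3.
Proof. by rewrite -(card_star v) subset_leq_card // subsetIr. Qed.

Lemma degreeC F v : degree (~: F) v = 3 - degree F v.
Proof.
have := cardsID F (star v); rewrite card_star /degree setDE => <-.
by rewrite setIC [F :&: _]setIC addKn.
Qed.

Lemma degree_countC F k : k <= 3 -> degree_count (~: F) k = degree_count F (3 - k).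
Proof.
move=> k3; apply: eq_card => v; rewrite !inE degreeC.
by have := degree_le3 F v; lia.
Qed.

Lemma toggleC F es : toggle (~: F) es = ~: toggle F es.
Proof. by apply/setP => e; rewrite !inE addNb. Qed.

Lemma is_moveC F s j a v es : is_move (~: F) s j a v es -> is_move F (~~ s) (3 - j) (3 - a) v es.
Proof.
case/and3P=> dv /allP all_es uniq_nb; apply/and3P; split=> //.
  by move: dv; rewrite degreeC => /eqP <-; rewrite subKn // degree_le3.
apply/allP => e /all_es/and3P[ve /eqP <-]; rewrite degreeC inE => /eqP <-.
by rewrite ve negbK eqxx subKn ?degree_le3 //=.
Qed.

Lemma sum_degree_count F :
  degree_count F 0 + degree_count F 1 + degree_count F 2 + degree_count F 3 = #|V|.
Proof.
rewrite !degree_countE -!big_split -sum1_card; apply: eq_bigr => v _ /=.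
by move: (degree F v) (degree_le3 F v) => [|[|[|[|]]]].
Qed.

Lemma even_card : ~~ odd #|V|.
Proof.
have := handshake [set: E]; under eq_bigr => v _.
  rewrite /degree setTI card_star; over.
rewrite sum_nat_const => h; have {h} : #|V| * 3 = 2 * #|[set: E]| := h.
by move: #|V| #|_| => a b; lia.
Qed.

Lemma even_odd_degrees F : ~~ odd (degree_count F 1 + degree_count F 3).
Proof.
have : \sum_v degree F v = degree_count F 1 + 2 * degree_count F 2 + 3 * degree_count F 3.
  rewrite !degree_countE !big_distrr -!big_split; apply: eq_bigr => v _ /=.
  by move: (degree F v) (degree_le3 F v) => [|[|[|[|]]]].
by rewrite handshake; lia.
Qed.

Lemma free_edge F v : degree F v <= 2 -> exists2 e, v \in ends G e & e \notin F.
Proof.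
move=> d2; have : 0 < degree (~: F) v by rewrite degreeC; lia.
by case/card_gt0P => e; rewrite !inE => /andP[eF ve]; exists e.
Qed.

Lemma degree_nonedge F v e : v \in ends G e -> e \notin F -> degree F v <= 2.
Proof.
move=> ve eF; suff : 0 < degree (~: F) v by rewrite degreeC; lia.
by apply/card_gt0P; exists e; rewrite !inE eF.
Qed.

Lemma is_move1 F v e : v \in ends G e ->
  is_move F (e \in F) (degree F v) (degree F (other_end v e)) v [:: e].
Proof. by move=> ve; rewrite /is_move /= ve !eqxx. Qed.

Lemma any_nonedge F i : i <= 2 -> 0 < degree_count F i ->
  exists2 k, k <= 2 & exists v e, is_move F false i k v [:: e].
Proof.
move=> i2 /card_gt0P[v]; rewrite inE => /eqP dv.
have [|e ve eF] := @free_edge F v; first by rewrite dv.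
exists (degree F (other_end v e)); first exact: degree_nonedge (other_end_in ve) eF.
by exists v, e; have := is_move1 F ve; rewrite dv (negPf eF).
Qed.

(** Otherwise every edge at a vertex of degree 0 uses up one of the
    [2 * m_1 + m_2] places for edges outside F at the vertices of degrees 1
    and 2. *)
Lemma top_nonedge F : 2 * degree_count F 1 + degree_count F 2 < 3 * degree_count F 0 ->
  exists v e, is_move F false 0 0 v [:: e].
Proof.
move=> lt; have [/existsP[v /existsP[e h]]|none] := boolP [exists v, [exists e, is_move F false 0 0 v [:: e]]].
  by exists v, e.
move: lt; rewrite ltnNge => /negP[].
pose D k := [set v | degree F v == k].
have sumD k : \sum_(v in D k) degree (~: F) v = (3 - k) * degree_count F k.
  rewrite /D (eq_bigr (fun => 3 - k)) ?sum_nat_const 1?mulnC // => v.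
  by rewrite inE => /eqP dv; rewrite degreeC dv.
rewrite -[3]/(3 - 0) -[2 * _]/((3 - 1) * _) -[degree_count F 2]mul1n -[1 * _]/((3 - 2) * _).
rewrite -!sumD !sum_degree -big_split /=.
apply: leq_sum => e; rewrite inE => eF.
have [->|/set0Pn[v]] := eqVneq (ends G e :&: D 0) set0; first by rewrite cards0.
rewrite !inE => /andP[ve /eqP dv].
have d_nb : degree F (other_end v e) != 0.
  apply: contra none => /eqP dn; apply/existsP; exists v; apply/existsP; exists e.
  by have := is_move1 F ve; rewrite dv dn (negPf eF).
have -> : ends G e :&: D 0 = [set v].
  apply/setP => w; rewrite !inE (mem_ends _ ve); have [->|_] /= := eqVneq w v; first by rewrite dv.
  by case: eqP => //= ->; rewrite (negPf d_nb).
have := degree_nonedge (other_end_in ve) eF; rewrite cards1.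
case dn: (degree F (other_end v e)) d_nb => [|[|[|//]]] // _ _.
  by apply: ltn_addr; apply/card_gt0P; exists (other_end v e); rewrite !inE dn other_end_in.
by apply: ltn_addl; apply/card_gt0P; exists (other_end v e); rewrite !inE dn other_end_in.
Qed.

(** Choose an edge outside F at every vertex of degree [i].  If all of them lead
    to vertices of degree [j], two of these edges meet, by the pigeonhole
    principle. *)
Lemma pair_nonedge F i j : i <= 2 -> degree_count F j < degree_count F i ->
  (exists k, [/\ k <= 2, k != j & exists v e, is_move F false i k v [:: e]]) \/
  exists v e e', is_move F false j i v [:: e; e'].
Proof.
move=> i2 lt.
have [/existsP[v /existsP[e /andP[h kj]]]|none] := boolP [exists v, [exists e,
   is_move F false i (degree F (other_end v e)) v [:: e] && (degree F (other_end v e) != j)]].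
  left; exists (degree F (other_end v e)); split=> //; last by exists v, e.
  case/and3P: h => _ /= /andP[/and3P[ve /eqP/negbT eF _] _] _.
  exact: degree_nonedge (other_end_in ve) eF.
right; pose D k := [set v | degree F v == k].
pose g v := [pick e in ~: F :&: star v]; pose h v := oapp (other_end v) v (g v).
have hP v : v \in D i -> exists e, [/\ h v = other_end v e, v \in ends G e, e \notin F & degree F (other_end v e) = j].
  rewrite inE => /eqP dv; rewrite /h /g; case: pickP => [e|no_e].
    rewrite !inE => /andP[eF ve]; exists e; split=> //; apply/eqP.
    apply: contraR none => kj; apply/existsP; exists v; apply/existsP; exists e.
    by rewrite kj andbT; have := is_move1 F ve; rewrite dv (negPf eF).
  have [|e ve eF] := @free_edge F v; first by rewrite dv.
  by have := no_e e; rewrite !inE eF ve.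
have : ~~ dinjectiveb h (D i).
  apply: contraL lt => /dinjectiveP inj; rewrite -leqNgt -[degree_count F i]/#|D i| -(card_in_imset inj).
  by apply/subset_leq_card/subsetP => _ /imsetP[v /hP[e [-> _ _ dn]] ->]; rewrite inE dn.
case/dinjectivePn => v vD [w]; rewrite inE => /andP[wv wD].
have [e [-> ve eF dn]] := hP v vD; have [e' [-> we' eF' _]] := hP w wD.
move: vD wD; rewrite !inE => dv dw nvw; exists (other_end v e), e, e'.
rewrite /is_move /= dn eqxx (other_end_in ve) (negPf eF) (negPf eF') (other_endK ve) nvw (other_end_in we') (other_endK we').
by rewrite dv dw inE eq_sym wv.
Qed.

End Moves.

(** * Local minima of the potential *)

Section LocalMinimum.
Variables (V E : finType) (G : multigraph V E).
Implicit Types (F : {set E}) (v w : V) (e : E) (es : seq E) (s : bool).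
Hypothesis cubicG : cubic G.

Definition unbalance F := imbalance #|V| (degree_count G F).

(** The kinds are not bounded here: [is_move] leaves only those with degrees
    at most 3. *)
Definition stable F := forall s j a v es, size es <= 2 -> is_move G F s j a v es ->
  unbalance F <= unbalance (toggle F es).

Lemma potential_toggle F s j a v es : is_move G F s j a v es ->
  Z.of_nat (unbalance (toggle F es)) =
    potential (moved s j a (size es) (deviation #|V| (degree_count G F))).
Proof.
move=> mv; rewrite /unbalance imbalanceE.
have step k : deviation #|V| (degree_count G (toggle F es)) k = moved s j a (size es) (deviation #|V| (degree_count G F)) k.
  by have := degree_count_toggle k mv; rewrite /deviation /moved; move: (gain _ _ _ _ _) (loss _ _ _ _); lia.
by rewrite /potential !step.
Qed.

Lemma stable_not_lowers F s j a v es : stable F -> size es <= 2 -> is_move G F s j a v es ->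
  ~ lowers (deviation #|V| (degree_count G F)) s j a (size es).
Proof.
move=> stF es2 mv; have := stF _ _ _ _ _ es2 mv.
have := potential_toggle mv; rewrite /lowers -imbalanceE -/(unbalance F) => <-; lia.
Qed.

Definition side s F : {set E} := if s then ~: F else F.

Lemma degree_count_side s F k : k <= 3 -> degree_count G (side s F) k = degree_count G F (mirror s k).
Proof. by case: s => //; apply: degree_countC. Qed.

Lemma is_move_side s F i k v es : is_move G (side s F) false i k v es ->
  is_move G F s (mirror s i) (mirror s k) v es.
Proof. by case: s => //; apply: is_moveC. Qed.

Lemma stable_not_forced F : stable F -> ~ forced (Z.of_nat #|V|) (deviation #|V| (degree_count G F)).
Proof.
move=> stF; have stuck := stable_not_lowers stF.
case=> [s i i2 pos low|s top low|s i j i2 j3 lt low1 low2].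
- have [] := any_nonedge cubicG (F := side s F) i2.
    by rewrite (degree_count_side _ _ (leqW i2)); move: pos; rewrite /deviation; lia.
  by move=> k k2 [v [e /is_move_side/stuck]]; apply=> //; apply: low.
- have [|v [e /is_move_side/stuck]] := top_nonedge cubicG (F := side s F); last exact.
  by rewrite !degree_count_side //; move: top; rewrite /deviation; lia.
- have [|[k [k2 kj [v [e /is_move_side/stuck]]]]|[v [e [e' /is_move_side/stuck]]]] :=
    pair_nonedge cubicG (F := side s F) (j := j) i2.
  + by rewrite (degree_count_side _ _ (leqW i2)) (degree_count_side _ _ j3); move: lt; rewrite /deviation; lia.
  + by apply=> //; apply: low1.
  + by apply.
Qed.

Lemma unbalanceC F : unbalance (~: F) = unbalance F.
Proof.
have := sum_degree_count cubicG F; rewrite /unbalance /imbalance !degree_countC //.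
move=> <-; rewrite ![3 - _]/=.
have -> : dist (4 * (degree_count G F 3 + degree_count G F 2)) (2 * (degree_count G F 0 + degree_count G F 1 + degree_count G F 2 + degree_count G F 3)) =
   dist (4 * (degree_count G F 0 + degree_count G F 1)) (2 * (degree_count G F 0 + degree_count G F 1 + degree_count G F 2 + degree_count G F 3)).
  by rewrite /dist; lia.
by rewrite [dist (4 * degree_count G F 3) _ - 4 + _]addnC [dist (4 * degree_count G F 2) _ - 4 + _]addnC.
Qed.

Lemma stableC F : stable F -> stable (~: F).
Proof.
move=> stF s j a v es es2 /(is_moveC cubicG) mv.
by rewrite toggleC !unbalanceC; apply: stF mv.
Qed.

(** Complementation allows assuming that at least half of the vertices have
    degree at most 1. *)
Theorem stable_balanced F k : stable F -> k <= 3 -> dist (4 * degree_count G F k) #|V| <= 8.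
Proof.
wlog half : F k / degree_count G F 2 + degree_count G F 3 <= degree_count G F 0 + degree_count G F 1.
  move=> wlog_half stF k3; have [/wlog_half|/ltnW half] := leqP (degree_count G F 2 + degree_count G F 3) (degree_count G F 0 + degree_count G F 1).
    exact.
  have := wlog_half (~: F) (3 - k); rewrite !degree_countC ?leq_subr // subKn //; apply=> //.
    by rewrite addnC [X in _ <= X]addnC.
  exact: stableC.
move=> stF k3; rewrite leqNgt; apply/negP => bad.
have sumc := sum_degree_count cubicG F.
have [V0|V0] := posnP #|V|.
  by move: bad; have : degree_count G F k <= #|V| by [exact: max_card]; rewrite V0 leqn0 => /eqP->.
have evn := even_card cubicG; have evo := even_odd_degrees cubicG F.
apply: (stable_not_forced stF).
have -> : Z.of_nat #|V| = (2 * Z.of_nat #|V|./2)%stdZ by lia.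
apply: (unbalanced_forced (m := fun k => Z.of_nat (degree_count G F k)) (p := Z.of_nat (degree_count G F 1 + degree_count G F 3)./2)).
- by move=> i; rewrite /deviation; lia.
- by lia.
- by lia.
- by rewrite /deviation; lia.
- by rewrite /deviation; lia.
- by exists k => //; rewrite /deviation; move: bad; rewrite /dist; lia.
Qed.

Lemma balanced_quarter F : (forall k, k <= 3 -> dist (4 * degree_count G F k) #|V| <= 8) ->
  quarter_degrees (spanning_subgraph G F).
Proof.
move=> bal k /bal; rewrite m_spanning; move: (degree_count G F k) #|V| => c n.
rewrite /dist => le8.
have up : ((4 * c)%N%:R <= (n + 8)%N%:R :> rat)%R by rewrite ler_nat; lia.
have lo : (n%:R <= (4 * c + 8)%N%:R :> rat)%R by rewrite ler_nat; lia.
rewrite ler_norml; move: up lo; rewrite !natrD => up lo.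
by apply/andP; split; lra.
Qed.

Theorem quarter_subgraph : exists F, quarter_degrees (spanning_subgraph G F).
Proof.
have [F _ minF] := @arg_minnP {set E} set0 predT unbalance isT.
exists F; apply: balanced_quarter => k; apply: stable_balanced => s j a v es _ _.
exact: minF.
Qed.
End LocalMinimum.

(** * Executing straight-line code and loops *)

(** [value] and [step] describe execution without the word bound, which is
    dealt with once and for all by [exec_straight]. *)
Fixpoint value (s : state) (e : expr) : nat :=
  match e with
  | Const k => k
  | Var x => var s x
  | Get a e1 => arr s a (value s e1)
  | Op o e1 e2 => binop_sem o (value s e1) (value s e2)
  end.

Fixpoint step (c : cmd) (s : state) : state :=
  match c with
  | Skip | While _ _ => s
  | Assign x e => set_var s x (value s e)
  | Store a e1 e2 => set_arr s a (value s e1) (value s e2)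
  | Seq c1 c2 => step c2 (step c1 s)
  | If b c1 c2 => if value s b != 0 then step c1 s else step c2 s
  end.

Fixpoint straight (c : cmd) : bool :=
  match c with
  | Skip | Assign _ _ | Store _ _ _ => true
  | Seq c1 c2 | If _ c1 c2 => straight c1 && straight c2
  | While _ _ => false
  end.

Fixpoint max_time (c : cmd) : nat :=
  match c with
  | Skip => 1
  | Assign _ e => (cost e).+1
  | Store _ e1 e2 => (cost e1 + cost e2).+1
  | Seq c1 c2 => max_time c1 + max_time c2
  | If b c1 c2 => (cost b).+1 + (max_time c1 + max_time c2)
  | While _ _ => 0
  end.

(** If all memory cells of a state are below [B >= 2], then all values that
    occur during the evaluation of [e] are below [B ^ expr_growth e], and all
    cells after running [c] are below [B ^ growth c].  The exponent depends on
    the program only, which turns a polynomial bound on the memory at the start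
    of straight-line code into a polynomial bound on the words it needs. *)
Fixpoint expr_growth (e : expr) : nat :=
  match e with
  | Const k => k.+1
  | Var _ => 1
  | Get _ e1 => expr_growth e1
  | Op _ e1 e2 => expr_growth e1 + expr_growth e2
  end.

Fixpoint growth (c : cmd) : nat :=
  match c with
  | Skip | While _ _ => 1
  | Assign _ e => expr_growth e
  | Store _ e1 e2 => expr_growth e1 + expr_growth e2
  | Seq c1 c2 => growth c1 * growth c2
  | If b c1 c2 => expr_growth b + growth c1 + growth c2
  end.

Definition bounded (B : nat) (s : state) : Prop :=
  (forall x, var s x < B) /\ (forall a i, arr s a i < B).

Lemma expr_growth_gt0 e : 0 < expr_growth e.
Proof. by elim: e => //= o e1 IH1 e2 IH2; rewrite addn_gt0 IH1. Qed.

Lemma growth_gt0 c : 0 < growth c.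
Proof.
elim: c => //= [x e|a e1 e2|c1 IH1 c2 IH2|b c1 IH1 c2 IH2].
- exact: expr_growth_gt0.
- by rewrite addn_gt0 expr_growth_gt0.
- by rewrite muln_gt0 IH1.
- by rewrite !addn_gt0 expr_growth_gt0.
Qed.

Lemma bounded_le B B' s : B <= B' -> bounded B s -> bounded B' s.
Proof. by move=> BB' [bv ba]; split=> *; apply: leq_trans BB'. Qed.

Lemma binop_lt o x y X Y : 1 < X -> 1 < Y -> x < X -> y < Y -> binop_sem o x y < X * Y.
Proof.
move=> X1 Y1 xX yY; have leX : X <= X * Y by rewrite leq_pmulr // ltnW.
case: o => /=; first by nia.
- by apply: leq_trans leX; exact: leq_ltn_trans (leq_subr _ _) xX.
- exact: ltn_mul.
- by apply: leq_trans leX; exact: leq_ltn_trans (leq_div _ _) xX.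
- by apply: leq_trans leX; exact: leq_ltn_trans (leq_mod _ _) xX.
- by apply: leq_trans leX; case: (x <= y); rewrite //= ltnW.
- by apply: leq_trans leX; case: (x == y); rewrite //= ltnW.
Qed.

Lemma eval_value W B s e : 1 < B -> bounded B s -> B ^ expr_growth e <= W ->
  eval W s e = Some (value s e) /\ value s e < B ^ expr_growth e.
Proof.
move=> B1 [bv ba]; have B0 : 0 < B by exact: ltnW.
have wordE x b : x < b -> b <= W -> word W x = Some x.
  by rewrite /word => xb bW; rewrite (leq_trans xb bW).
elim: e => [k|x|a e1 IH|o e1 IH1 e2 IH2] /= leW.
- have kB : k < B ^ k.+1 by apply: ltn_trans (ltn_expl k.+1 B1).
  by rewrite (wordE _ _ kB leW).
- by rewrite expn1 in leW *; rewrite (wordE _ _ (bv x) leW).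
- have [-> _] := IH leW; have aB : arr s a (value s e1) < B ^ expr_growth e1.
    by apply: leq_trans (ba _ _) _; rewrite -{1}(expn1 B) leq_exp2l // expr_growth_gt0.
  by rewrite /= (wordE _ _ aB leW).
- rewrite expnD in leW *.
  have g1 : 1 < B ^ expr_growth e1 by rewrite -(exp1n (expr_growth e1)) ltn_exp2r // expr_growth_gt0.
  have g2 : 1 < B ^ expr_growth e2 by rewrite -(exp1n (expr_growth e2)) ltn_exp2r // expr_growth_gt0.
  have [->  l1] := IH1 (leq_trans (leq_pmulr _ (ltnW g2)) leW).
  have [->  l2] := IH2 (leq_trans (leq_pmull _ (ltnW g1)) leW).
  have lt := binop_lt o g1 g2 l1 l2.
  by rewrite /= (wordE _ _ lt leW).
Qed.

Lemma bounded_set_var B s x v : bounded B s -> v < B -> bounded B (set_var s x v).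
Proof. by move=> [bv ba] vB; split=> //= y; case: eqP. Qed.

Lemma bounded_set_arr B s a i v : bounded B s -> v < B -> bounded B (set_arr s a i v).
Proof. by move=> [bv ba] vB; split=> //= b j; case: ifP. Qed.

Lemma exec_straight W B c s : straight c -> 1 < B -> bounded B s -> B ^ growth c <= W ->
  (exists2 t, exec W c s t (step c s) & t <= max_time c) /\ bounded (B ^ growth c) (step c s).
Proof.
elim: c B s => [|x e|a e1 e2|c1 IH1 c2 IH2|b c1 IH1 c2 IH2|//] B s /= st B1 bd leW.
- by split; [exists 1 => //; constructor|rewrite expn1].
- have [ev lt] := eval_value B1 bd leW; split; first by exists (cost e).+1 => //; constructor.
  apply: bounded_set_var lt; apply: bounded_le bd.
  by rewrite -{1}(expn1 B) leq_exp2l // expr_growth_gt0.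
- have B0 := ltnW B1.
  have le1 : B ^ expr_growth e1 <= B ^ (expr_growth e1 + expr_growth e2) by rewrite leq_exp2l // leq_addr.
  have le2 : B ^ expr_growth e2 <= B ^ (expr_growth e1 + expr_growth e2) by rewrite leq_exp2l // leq_addl.
  have [ev1 _] := eval_value B1 bd (leq_trans le1 leW).
  have [ev2 lt] := eval_value B1 bd (leq_trans le2 leW).
  split; first by exists (cost e1 + cost e2).+1 => //; constructor.
  apply: bounded_set_arr (leq_trans lt le2); apply: bounded_le bd.
  by rewrite -{1}(expn1 B) leq_exp2l // addn_gt0 expr_growth_gt0.
- case/andP: st => st1 st2; rewrite expnM in leW *.
  have B1' : 1 < B ^ growth c1.
    by rewrite (leq_trans B1) // -{1}(expn1 B) leq_exp2l // growth_gt0.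
  have le1 : B ^ growth c1 <= W.
    by apply: leq_trans leW; rewrite -{1}(expn1 (B ^ _)) leq_exp2l // growth_gt0.
  have [[t1 ex1 le_t1] bd1] := IH1 _ _ st1 B1 bd le1.
  have [[t2 ex2 le_t2] bd2] := IH2 _ _ st2 B1' bd1 leW.
  split=> //; exists (t1 + t2); first exact: ExecSeq ex1 ex2.
  exact: leq_add.
- case/andP: st => st1 st2.
  have le g : g <= expr_growth b + growth c1 + growth c2 ->
      B ^ g <= B ^ (expr_growth b + growth c1 + growth c2) by move=> ?; rewrite leq_exp2l.
  have leb := le (expr_growth b) ltac:(lia).
  have le1 := le (growth c1) ltac:(lia); have le2 := le (growth c2) ltac:(lia).
  have [ev _] := eval_value B1 bd (leq_trans leb leW).
  have [[t1 ex1 le_t1] bd1] := IH1 _ _ st1 B1 bd (leq_trans le1 leW).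
  have [[t2 ex2 le_t2] bd2] := IH2 _ _ st2 B1 bd (leq_trans le2 leW).
  have [b0|b0] := eqVneq (value s b) 0.
    split; last exact: bounded_le bd2.
    exists ((cost b).+1 + t2); last by lia.
    by apply: ExecIfFalse => //; rewrite ev b0.
  split; last exact: bounded_le bd1.
  exists ((cost b).+1 + t1); last by lia.
  exact: ExecIfTrue ev b0 ex1.
Qed.

(** The bound [B] must come from the invariant, since the bound given by
    [growth] would get worse with every iteration. *)
Lemma exec_while W B b c (I : state -> Prop) (mu : state -> nat) s :
  straight c -> 1 < B -> B ^ expr_growth b <= W -> B ^ growth c <= W ->
  (forall s, I s -> bounded B s) ->
  (forall s, I s -> value s b != 0 -> I (step c s) /\ mu (step c s) < mu s) ->
  I s ->
  exists t s', [/\ exec W (While b c) s t s', I s', value s' b = 0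
                 & t <= (mu s).+1 * ((cost b).+1 + max_time c)].
Proof.
move=> st B1 leb lec Ib Istep.
elim: {s}(mu s).+1 {-2}s (ltnSn (mu s)) => // d IH s mu_lt Is.
have [ev _] := eval_value B1 (Ib s Is) leb.
have [b0|b0] := eqVneq (value s b) 0.
  exists (cost b).+1, s; split=> //; first by constructor; rewrite ev b0.
  by rewrite mulSn; lia.
have [Is1 lt] := Istep s Is b0.
have [[t1 ex1 le1] _] := exec_straight st B1 (Ib s Is) lec.
have [|t2 [s2 [ex2 Is2 b2 le2]]] := IH _ _ Is1; first exact: leq_trans lt mu_lt.
exists ((cost b).+1 + t1 + t2), s2; split=> //; first exact: ExecWhileTrue ev b0 ex1 ex2.
rewrite mulSn; apply: leq_add; first by rewrite leq_add2l.
by apply: leq_trans le2 _; rewrite leq_mul2r lt orbT.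
Qed.

Definition block (cs : seq cmd) : cmd := foldr Seq Skip cs.

Lemma step_block_cat cs1 cs2 s : step (block (cs1 ++ cs2)) s = step (block cs2) (step (block cs1) s).
Proof. by elim: cs1 s => //= c cs IH s; rewrite IH. Qed.

Fixpoint reads_var (x : nat) (e : expr) : bool :=
  match e with
  | Const _ => false
  | Var y => y == x
  | Get _ e1 => reads_var x e1
  | Op _ e1 e2 => reads_var x e1 || reads_var x e2
  end.

Fixpoint reads_arr (a : nat) (e : expr) : bool :=
  match e with
  | Const _ | Var _ => false
  | Get b e1 => (b == a) || reads_arr a e1
  | Op _ e1 e2 => reads_arr a e1 || reads_arr a e2
  end.

Lemma value_agree s s' e :
  (forall x, reads_var x e -> var s' x = var s x) ->
  (forall a i, reads_arr a e -> arr s' a i = arr s a i) ->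
  value s' e = value s e.
Proof.
elim: e => [k|x|a e IH|o e1 IH1 e2 IH2] //= hv ha.
- by apply: hv; rewrite eqxx.
- rewrite IH // => [|b i h]; last by apply: ha; rewrite h orbT.
  by apply: ha; rewrite eqxx.
- rewrite IH1 ?IH2 // => [x h|a i h|x h|a i h]; try (by apply: hv; rewrite h ?orbT);
  by apply: ha; rewrite h ?orbT.
Qed.

Lemma step_stores a (f : nat -> expr) c ss s :
  {in ss, forall i, ~~ reads_arr a (f i)} ->
  let s' := step (block [seq Store a (f i) (Const c) | i <- ss]) s in
  (forall x, var s' x = var s x) /\
  (forall b j, arr s' b j =
     if (b == a) && (j \in [seq value s (f i) | i <- ss]) then c else arr s b j).
Proof.
elim: ss s => [|i ss IH] s nr /=; first by split=> // b j; rewrite andbF.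
have [|hv ha] := IH (set_arr s a (value s (f i)) c).
  by move=> i' i's; apply: nr; rewrite inE i's orbT.
split=> // b j; rewrite ha /= inE.
have -> : [seq value (set_arr s a (value s (f i)) c) (f i0) | i0 <- ss] = [seq value s (f i0) | i0 <- ss].
  apply/eq_in_map => i' i's; apply: value_agree => //= b' j' r; case: eqP r => // ->.
  by rewrite (negPf (nr i' _)) // inE i's orbT.
by case: (b == a) => //=; case: (j == _); case: (j \in _).
Qed.

Lemma step_assigns (g : nat -> nat) (f : nat -> expr) ks s : uniq (map g ks) ->
  {in ks &, forall k k', reads_var (g k) (f k') -> k = k'} ->
  let s' := step (block [seq Assign (g k) (f k) | k <- ks]) s in
  [/\ {in ks, forall k, var s' (g k) = value s (f k)},
      (forall x, x \notin map g ks -> var s' x = var s x)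
    & (forall b j, arr s' b j = arr s b j)].
Proof.
elim: ks s => [|k ks IH] s //= /andP[gk un] nr.
have [||h1 h2 h3] := IH (set_var s (g k) (value s (f k))) => //.
  by move=> k1 k2 i1 i2; apply: nr; rewrite inE ?i1 ?i2 orbT.
split=> [k'|x|b j]; last by rewrite h3.
  rewrite inE => /orP[/eqP->|k'ks]; first by rewrite h2 //= eqxx.
  rewrite h1 //; apply: value_agree => //= x r; case: eqP r => // -> r.
  have kk' : k = k' by apply: nr r; rewrite inE ?eqxx ?k'ks ?orbT.
  by case/mapP: gk; exists k'; rewrite // kk'.
by rewrite inE negb_or => /andP[/negPf xk xks]; rewrite h2 //= xk.
Qed.

Lemma step_pushes a x (ws : seq expr) s :
  all (fun w => ~~ reads_arr a w && ~~ reads_var x w) ws ->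
  let s' := step (block (flatten [seq [:: Store a (Var x) w; Assign x (Op OpAdd (Var x) (Const 1))] | w <- ws])) s in
  (forall y, var s' y = if y == x then var s x + size ws else var s y) /\
  (forall b j, arr s' b j = if (b == a) && (var s x <= j < var s x + size ws)
      then nth 0 (map (value s) ws) (j - var s x) else arr s b j).
Proof.
elim: ws s => [|w ws IH] s /=.
  move=> _; split=> [y|b j]; first by case: eqP => // ->; rewrite addn0.
  by rewrite addn0 ltnNge andbN andbF.
case/andP=> _ nr; set s1 := set_var _ _ _; have [hv ha] := IH s1 nr.
have x1 : var s1 x = (var s x).+1 by rewrite /s1 /= eqxx addn1.
split=> [y|b j].
  by rewrite hv x1 /= addSnnS; case: eqP => // /eqP/negPf h; rewrite /s1 /= h.
rewrite ha x1 /=.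
have -> : map (value s1) ws = map (value s) ws.
  elim: ws nr {IH hv ha} => //= w' ws IH /andP[/andP[na nx] /IH->]; congr cons.
  apply: value_agree => [y|b' j'] r /=.
    by case: eqP r => // ->; rewrite (negPf nx).
  by case: eqP r => // ->; rewrite (negPf na).
case: (eqVneq b a) => //= _; rewrite addSnnS.
have [lt|le] := ltnP j (var s x).+1.
  rewrite andFb; have [->|ne] := eqVneq j (var s x).
    by rewrite subnn leqnn /= addnS ltnS leq_addr.
  by rewrite leqNgt ltn_neqAle ne -ltnS lt.
have ne : j != var s x by rewrite neq_ltn le orbT.
rewrite (negPf ne) /= (ltnW le) /=; case: ifP => // _.
by have -> : j - var s x = (j - (var s x).+1).+1 by lia.
Qed.

(** * The program *)

Definition less e1 e2 := Op OpLeq (Op OpAdd e1 (Const 1)) e2.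
Definition equal e1 e2 := Op OpEq e1 e2.
Definition conj es := foldr (Op OpMul) (Const 1) es.

Lemma all_cons (T : Type) (p : pred T) x l : all p (x :: l) = p x && all p l.
Proof. by []. Qed.

Lemma valueE s : ((forall x, value s (Var x) = var s x) * (forall c, value s (Const c) = c)
  * (forall a e, value s (Get a e) = arr s a (value s e)))%type.
Proof. by []. Qed.

Lemma value_less s e1 e2 : (value s (less e1 e2) != 0) = (value s e1 < value s e2).
Proof. by rewrite /less /= addn1 eqb0 negbK. Qed.

Lemma value_equal s e1 e2 : (value s (equal e1 e2) != 0) = (value s e1 == value s e2).
Proof. by rewrite /equal /= eqb0 negbK. Qed.

Lemma value_conj s es : (value s (conj es) != 0) = all (fun e => value s e != 0) es.
Proof. by rewrite /conj; elim: es => //= e es <-; rewrite muln_eq0 negb_or. Qed.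

(** A kind of move is coded by a number [t < 64]. *)
Definition kind_flag t := odd t.
Definition kind_size t := (odd t./2).+1.
Definition kind_deg t := t./2./2 %% 4.
Definition kind_other t := t %/ 16.

Lemma kindP s j a r : j <= 3 -> a <= 3 -> 0 < r <= 2 ->
  exists2 t, t < 64 & [/\ kind_flag t = s, kind_size t = r, kind_deg t = j & kind_other t = a].
Proof.
move=> j3 a3 r12; exists (s + 2 * r.-1 + 4 * j + 16 * a).
  by case: s; lia.
by case: s r r12 j j3 a a3 => [] [|[|[|[]]]] // _ [|[|[|[|[]]]]] // _ [|[|[|[|[]]]]].
Qed.

(** Memory layout.
    Variables: 0 and 1 hold the numbers of vertices and edges, 2 the vertex
    being examined, 3 an edge counter, [4 + j] the number of vertices of degree
    [j], 8 the length of the log, [10 + t] the pointer of kind [t].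
    Arrays: 0 and 1 hold the ends of the edges, 2 the flags that represent F,
    3 the edges at [v] in the cells [3 * v], [3 * v + 1], [3 * v + 2] (the slots
    of [v]), 4 the degrees in F, 5 the numbers of slots filled so far, 6 the
    log. *)
Definition slot_expr w i := Get 3 (Op OpAdd (Op OpMul (Const 3) w) (Const i)).

(** The other end of an edge with ends [a] and [b] is [a + b - v], in whichever
    order the ends are listed. *)
Definition other_expr w i := Op OpSub (Op OpAdd (Get 0 (slot_expr w i)) (Get 1 (slot_expr w i))) w.
Definition slot_lists r : seq (seq nat) :=
  if r == 1 then [seq [:: i] | i <- iota 0 3]
  else [seq [:: i; i'] | i <- iota 0 3, i' <- iota 0 3].

Definition match_expr t ss := conj (equal (Get 4 (Var 2)) (Const (kind_deg t)) ::
  [seq conj [:: equal (Get 2 (slot_expr (Var 2) i)) (Const (kind_flag t));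
               equal (Get 4 (other_expr (Var 2) i)) (Const (kind_other t))] | i <- ss]
  ++ if ss is [:: i; i']
     then [:: equal (equal (other_expr (Var 2) i) (other_expr (Var 2) i')) (Const 0)]
     else [::]).

Definition new_count_expr t j := Op OpSub
  (Op OpAdd (Var (4 + j)) (Const (gain (kind_flag t) (kind_deg t) (kind_other t) (kind_size t) j)))
  (Const (loss (kind_deg t) (kind_other t) (kind_size t) j)).

(** The ends of the 13 walks of length at most 2 from the examined vertex, with
    repetitions. *)
Definition nearby : seq expr := Var 2 :: [seq other_expr (Var 2) i | i <- iota 0 3] ++
  [seq other_expr (other_expr (Var 2) i) i' | i <- iota 0 3, i' <- iota 0 3].

Definition toggle_edges t ss := block
  [seq Store 2 (slot_expr (Var 2) i) (Const (~~ kind_flag t)) | i <- ss].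
Definition shift_others t ss := block
  [seq Store 4 (other_expr (Var 2) i)
     (Const (shift (kind_flag t) 1 (kind_other t))) | i <- ss].
Definition shift_center t :=
  Store 4 (Var 2) (Const (shift (kind_flag t) (kind_size t) (kind_deg t))).
Definition update_counts t := block [seq Assign (4 + j) (new_count_expr t j) | j <- iota 0 4].
Definition append_log (ws : seq expr) :=
  block (flatten [seq [:: Store 6 (Var 8) w; Assign 8 (Op OpAdd (Var 8) (Const 1))] | w <- ws]).

Definition apply_move t ss := block
  [:: toggle_edges t ss; shift_others t ss; shift_center t; update_counts t; append_log nearby].

Definition try_moves t :=
  foldr (fun ss c => If (match_expr t ss) (apply_move t ss) c) Skip
    (slot_lists (kind_size t)).

Definition process t := block
  [:: Assign 2 (Get 6 (Var (10 + t)));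
      Assign (10 + t) (Op OpAdd (Var (10 + t)) (Const 1));
      try_moves t].

Definition dist_expr e1 e2 := Op OpAdd (Op OpSub e1 e2) (Op OpSub e2 e1).
Definition excess_expr e := Op OpSub (dist_expr (Op OpMul (Const 4) e) (Var 0)) (Const 4).
Definition imbalance_expr (f : nat -> expr) :=
  Op OpAdd
   (Op OpAdd (Op OpMul (Const 4) (Op OpAdd (excess_expr (f 0)) (excess_expr (f 3))))
             (Op OpMul (Const 3) (Op OpAdd (excess_expr (f 1)) (excess_expr (f 2)))))
   (Op OpMul (Const 3) (dist_expr (Op OpMul (Const 4) (Op OpAdd (f 0) (f 1)))
                                  (Op OpMul (Const 2) (Var 0)))).

Definition test_expr t := conj [:: less (Var (10 + t)) (Var 8);
  less (imbalance_expr (new_count_expr t)) (imbalance_expr (fun j => Var (4 + j)))].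

(** The guard is the sum of all tests, which is nonzero if one of them succeeds;
    the body then carries out the first such test. *)
Definition guard := foldr (fun t e => Op OpAdd (test_expr t) e) (Const 0) (iota 0 64).
Definition body := foldr (fun t c => If (test_expr t) (process t) c) Skip (iota 0 64).

Definition record_end b :=
  [:: Store 3 (Op OpAdd (Op OpMul (Const 3) (Get b (Var 3))) (Get 5 (Get b (Var 3)))) (Var 3);
      Store 5 (Get b (Var 3)) (Op OpAdd (Get 5 (Get b (Var 3))) (Const 1))].
Definition tabulate_body :=
  block (record_end 0 ++ record_end 1 ++ [:: Assign 3 (Op OpAdd (Var 3) (Const 1))]).
Definition enqueue_body :=
  block [:: Store 6 (Var 8) (Var 8); Assign 8 (Op OpAdd (Var 8) (Const 1))].

Definition program := block
  [:: While (less (Var 3) (Var 1)) tabulate_body;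
      While (less (Var 8) (Var 0)) enqueue_body;
      Assign 4 (Var 0);
      While guard body].

Lemma value_imbalance_expr s f : value s (imbalance_expr f) = imbalance (var s 0) (fun j => value s (f j)).
Proof. by []. Qed.

Lemma value_sum (T : nat -> expr) ts s :
  value s (foldr (fun t e => Op OpAdd (T t) e) (Const 0) ts) = \sum_(t <- ts) value s (T t).
Proof. by elim: ts => [|t ts IH]; rewrite ?big_nil // big_cons -IH. Qed.

Lemma step_select (A : eqType) (T : A -> expr) (Q : A -> cmd) l s :
  let c := foldr (fun x c => If (T x) (Q x) c) Skip l in
  (exists2 x, x \in l & value s (T x) != 0 /\ step c s = step (Q x) s) \/
  ({in l, forall x, value s (T x) = 0} /\ step c s = s).
Proof.
elim: l => [|x l IH] /=; first by right.
have [x0|x1] := eqVneq (value s (T x)) 0; last by left; exists x; rewrite ?mem_head.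
case: IH => [[y yl Qy]|[l0 E]]; first by left; exists y; rewrite // inE yl orbT.
by right; split=> // y; rewrite inE => /orP[/eqP->|/l0].
Qed.

Section Representation.
Variables (n k : nat) (G : multigraph 'I_n 'I_k) (s0 : state).
Hypothesis cubicG : cubic G.
Hypothesis inputG : edge_list G s0.
Implicit Types (s : state) (F : {set 'I_k}) (v : 'I_n) (e : 'I_k).

Lemma ends_input e v : (v \in ends G e) = (v == arr s0 0 e :> nat) || (v == arr s0 1 e :> nat).
Proof. by case: inputG => _ _ _ -> _; rewrite inE. Qed.

Lemma ends_other_input e v : v \in ends G e ->
  (v = arr s0 0 e :> nat /\ other_end G v e = arr s0 1 e :> nat) \/
  (v = arr s0 1 e :> nat /\ other_end G v e = arr s0 0 e :> nat).
Proof.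
move=> ve; have nbv : other_end G v e != v by case: (ends_other ve).
have := other_end_in ve; have := ve; rewrite !ends_input => /orP[] /eqP v_ /orP[] /eqP n_.
- by case/eqP: nbv; apply/val_inj; rewrite /= v_ n_.
- by left.
- by right.
- by case/eqP: nbv; apply/val_inj; rewrite /= v_ n_.
Qed.

Definition table s := forall v : 'I_n,
  (forall i, i < 3 -> exists2 e : 'I_k, arr s 3 (3 * v + i) = e & v \in ends G e) /\
  (forall e, v \in ends G e -> exists2 i, i < 3 & arr s 3 (3 * v + i) = e).

Record encodes s F : Prop := Encodes {
  enc_card : var s 0 = n;
  enc_ends : forall b i, b < 2 -> arr s b i = arr s0 b i;
  enc_table : table s;
  enc_flag : forall e : 'I_k, arr s 2 e = (e \in F);
  enc_degree : forall v : 'I_n, arr s 4 v = degree G F v;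
  enc_count : forall j, j < 4 -> var s (4 + j) = degree_count G F j }.

Lemma table_ext s s' : (forall i, arr s' 3 i = arr s 3 i) -> table s -> table s'.
Proof.
move=> E ts v; have [slot_edge edge_slot] := ts v.
by split=> [i /slot_edge|e /edge_slot] [x]; rewrite -E => *; exists x.
Qed.

Lemma value_slot_expr s w v i : value s w = v -> value s (slot_expr w i) = arr s 3 (3 * v + i).
Proof. by rewrite /slot_expr /= => ->. Qed.

Lemma value_other_expr s w v i e : (forall b i, b < 2 -> arr s b i = arr s0 b i) ->
  value s w = v -> arr s 3 (3 * v + i) = e -> v \in ends G e ->
  value s (other_expr w i) = other_end G v e.
Proof.
move=> se sw si ve; rewrite /other_expr /= sw si !se //.
by have [[<- <-]|[<- <-]] := ends_other_input ve; rewrite ?addKn ?addnK.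
Qed.

Lemma edges_of_slots s v ss : table s -> all (fun i => i < 3) ss ->
  exists2 es : seq 'I_k, [seq arr s 3 (3 * v + i) | i <- ss] = map val es & all (fun e => v \in ends G e) es.
Proof.
move=> ts; elim: ss => [|i ss IH] /=; first by exists [::].
case/andP=> i3 /IH[es eq_es all_es]; have [e ie ve] := (ts v).1 i i3.
by exists (e :: es); rewrite /= ?ie ?eq_es ?ve.
Qed.

Lemma slots_of_edges s v (es : seq 'I_k) : table s -> all (fun e => v \in ends G e) es ->
  exists2 ss, [seq arr s 3 (3 * v + i) | i <- ss] = map val es & all (fun i => i < 3) ss.
Proof.
move=> ts; elim: es => [|e es IH] /=; first by exists [::].
case/andP=> ve /IH[ss eq_ss all_ss]; have [i i3 ie] := (ts v).2 e ve.
by exists (i :: ss); rewrite /= ?ie ?eq_ss ?i3.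
Qed.

Lemma slot_listsP r ss : 0 < r <= 2 -> (ss \in slot_lists r) = (size ss == r) && all (fun i => i < 3) ss.
Proof.
move=> r12; have /orP[] : (r == 1) || (r == 2) by case: r r12 => [|[|[|]]].
  move/eqP->; apply/idP/idP; last by case: ss => [|[|[|[|i]]] [|j ss]].
  by move: ss; apply/allP.
move/eqP->; apply/idP/idP; last first.
  by case: ss => [|[|[|[|i]]] [|[|[|[|j]]] [|l ss]]].
by move: ss; apply/allP.
Qed.

(** The list [es] is the list of edges in the slots [ss]. *)
Lemma value_match_expr s F t ss v (es : seq 'I_k) : encodes s F -> var s 2 = v ->
  [seq arr s 3 (3 * v + i) | i <- ss] = map val es -> all (fun e => v \in ends G e) es ->
  size es <= 2 ->
  (value s (match_expr t ss) != 0) = is_move G F (kind_flag t) (kind_deg t) (kind_other t) v es.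
Proof.
move=> [_ se ts sf sd _] sv eq_es all_es es2.
rewrite value_conj all_cons value_equal !valueE sv sd; congr andb.
have svE : value s (Var 2) = v := sv.
have edge i e : arr s 3 (3 * v + i) = e -> v \in ends G e ->
    (value s (conj [:: equal (Get 2 (slot_expr (Var 2) i)) (Const (kind_flag t));
               equal (Get 4 (other_expr (Var 2) i)) (Const (kind_other t))]) != 0) =
    [&& v \in ends G e, (e \in F) == kind_flag t & degree G F (other_end G v e) == kind_other t].
  move=> ie ve; rewrite value_conj !all_cons andbT !value_equal ve.
  have -> : value s (Get 2 (slot_expr (Var 2) i)) = (e \in F) by rewrite /= sv ie sf.
  have -> : value s (Get 4 (other_expr (Var 2) i)) = degree G F (other_end G v e).
    by rewrite -sd -(value_other_expr se svE ie ve).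
  by case: (e \in F) (kind_flag t) => [] [].
have nbv i e : arr s 3 (3 * v + i) = e -> v \in ends G e -> value s (other_expr (Var 2) i) = other_end G v e.
  exact: value_other_expr.
case: es eq_es all_es es2 => [|e [|e' [|]]] //; case: ss => [|i [|i' [|]]] //.
- move=> [ie] /andP[ve _] _; rewrite [map _ _]/= [_ ++ _]/= all_cons (edge i e) //.
  by rewrite all_cons [all _ [::]]/= andbT [uniq _]/= andbT.
- move=> [ie ie'] /and3P[ve ve' _] _.
  rewrite [map _ [:: i; i']]/= [_ ++ _]/= !all_cons (edge i e) // (edge i' e') //.
  rewrite value_equal valueE.
  rewrite -[value s (equal _ _) == 0]negbK value_equal (nbv i e) // (nbv i' e') //.
  by rewrite [all _ [::]]/= [uniq _]/= inE !andbT -!andbA.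
Qed.

Definition near v (w : 'I_n) : Prop :=
  w = v \/ (exists2 e, v \in ends G e & w = other_end G v e) \/
  exists e e', [/\ v \in ends G e, other_end G v e \in ends G e' & w = other_end G (other_end G v e) e'].

Lemma value_nearby s v : (forall b i, b < 2 -> arr s b i = arr s0 b i) -> table s -> var s 2 = v ->
  (forall x, x \in map (value s) nearby -> exists w : 'I_n, x = w) /\
  (forall w, near v w -> val w \in map (value s) nearby).
Proof.
move=> se ts sv; have svE : value s (Var 2) = v := sv.
have nbs w (u : 'I_n) : value s w = u -> forall i, i < 3 ->
    exists2 e : 'I_k, value s (other_expr w i) = other_end G u e & u \in ends G e.
  move=> wu i i3; have [e ie ue] := (ts u).1 i i3.
  by exists e => //; apply: value_other_expr ie ue.
have nbs' w (u : 'I_n) : value s w = u -> forall e, u \in ends G e ->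
    exists2 i, i < 3 & value s (other_expr w i) = other_end G u e.
  move=> wu e ue; have [i i3 ie] := (ts u).2 e ue.
  by exists i => //; apply: value_other_expr ie ue.
rewrite /nearby map_cons map_cat -map_comp map_allpairs; split.
  move=> x; rewrite inE mem_cat => /or3P[/eqP->|/mapP[i]|/allpairsP[[i i'] []]].
  - by exists v.
  - by rewrite mem_iota => /(nbs _ _ svE)[e /= -> _] ->; exists (other_end G v e).
  - rewrite !mem_iota => /(nbs _ _ svE)[e ve _] /(nbs _ _ ve)[e' /= -> _] ->.
    by exists (other_end G (other_end G v e) e').
move=> w; rewrite inE mem_cat => -[->|[[e ve ->]|[e [e' [ve ne ->]]]]].
- by rewrite svE eqxx.
- have [i i3 ie] := nbs' _ _ svE _ ve; apply/or3P/Or32.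
  by rewrite -[val _]ie; apply: (map_f (fun i => value s (other_expr (Var 2) i))); rewrite mem_iota.
- have [i i3 ie] := nbs' _ _ svE _ ve; have [i' i'3 ie'] := nbs' _ _ ie _ ne.
  apply/or3P/Or33; rewrite -[val _]ie'.
  by apply: (allpairs_f (fun i i' => value s (other_expr (other_expr (Var 2) i) i'))); rewrite mem_iota.
Qed.

Lemma kind_other_le t : t < 64 -> kind_other t <= 3.
Proof. by move=> t64; rewrite /kind_other; lia. Qed.

Lemma step_block5 c1 c2 c3 c4 c5 s :
  step (block [:: c1; c2; c3; c4; c5]) s = step c5 (step c4 (step c3 (step c2 (step c1 s)))).
Proof. by []. Qed.

(* The generic form [step_block5] avoids unfolding the five blocks. *)
Lemma apply_moveE t ss s :
  step (apply_move t ss) s = step (append_log nearby) (step (update_counts t)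
    (step (shift_center t) (step (shift_others t ss) (step (toggle_edges t ss) s)))).
Proof. exact: step_block5. Qed.

Lemma toggle_edgesP s t ss v (es : seq 'I_k) : value s (Var 2) = v ->
  [seq arr s 3 (3 * v + i) | i <- ss] = map val es ->
  (forall x, var (step (toggle_edges t ss) s) x = var s x) /\
  (forall b j, arr (step (toggle_edges t ss) s) b j =
     if (b == 2) && (j \in map val es) then nat_of_bool (~~ kind_flag t) else arr s b j).
Proof.
move=> svE eq_es; have [|h1 h2] := @step_stores 2 (fun i => slot_expr (Var 2) i) (~~ kind_flag t) ss s; first by [].
split=> // b j; rewrite h2 -eq_es; congr (if _ && (_ \in _) then _ else _).
by apply: eq_map => i; rewrite (value_slot_expr _ svE).
Qed.

Lemma shift_othersP t s v ss (es : seq 'I_k) : (forall b i, b < 2 -> arr s b i = arr s0 b i) ->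
  value s (Var 2) = v -> [seq arr s 3 (3 * v + i) | i <- ss] = map val es ->
  all (fun e => v \in ends G e) es ->
  (forall x, var (step (shift_others t ss) s) x = var s x) /\
  (forall b j, arr (step (shift_others t ss) s) b j =
   if (b == 4) && (j \in [seq val (other_end G v e) | e <- es])
   then shift (kind_flag t) 1 (kind_other t) else arr s b j).
Proof.
move=> se sv eq_es all_es.
have [|h1 h2] := @step_stores 4 (fun i => other_expr (Var 2) i) (shift (kind_flag t) 1 (kind_other t)) ss s; first by [].
split=> // b j; rewrite h2; congr (if _ && (_ \in _) then _ else _).
elim: es ss eq_es all_es {h1 h2} => [|e es IH] [|i ss] //= [ie /IH{}IH] /andP[ve /IH->].
by congr cons; exact: (value_other_expr se sv ie ve).
Qed.

Lemma update_countsP t s : let s' := step (update_counts t) s in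
  [/\ (forall j, j < 4 -> var s' (4 + j) =
        var s (4 + j) + gain (kind_flag t) (kind_deg t) (kind_other t) (kind_size t) j
        - loss (kind_deg t) (kind_other t) (kind_size t) j),
      (forall x, x \notin map (addn 4) (iota 0 4) -> var s' x = var s x)
    & (forall b j, arr s' b j = arr s b j)].
Proof.
have [||h1 h2 h3] := @step_assigns (addn 4) (new_count_expr t) (iota 0 4) s; first by [].
  by move=> j j' _ _ /=; rewrite !orbF eqn_add2l => /eqP.
by split=> // j j4; apply: h1; rewrite mem_iota.
Qed.

Lemma append_logP (ws : seq expr) s : all (fun w => ~~ reads_arr 6 w && ~~ reads_var 8 w) ws ->
  (forall y, var (step (append_log ws) s) y = if y == 8 then var s 8 + size ws else var s y) /\
  (forall b j, arr (step (append_log ws) s) b j =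
     if (b == 6) && (var s 8 <= j < var s 8 + size ws) then nth 0 (map (value s) ws) (j - var s 8)
     else arr s b j).
Proof. exact: step_pushes. Qed.

Lemma apply_moveP B s F t ss v (es : seq 'I_k) : t < 64 -> encodes s F -> var s 2 = v ->
  [seq arr s 3 (3 * v + i) | i <- ss] = map val es -> all (fun e => v \in ends G e) es ->
  size es = kind_size t -> is_move G F (kind_flag t) (kind_deg t) (kind_other t) v es ->
  n + 5 < B -> var s 8 + 13 < B -> bounded B s ->
  let s' := step (apply_move t ss) s in
  [/\ [/\ encodes s' (toggle F es), bounded B s' & var s' 8 = var s 8 + 13],
      (forall x, 9 <= x -> var s' x = var s x),
      (forall i, i < var s 8 -> arr s' 6 i = arr s 6 i),
      (forall i, var s 8 <= i < var s 8 + 13 -> exists w : 'I_n, arr s' 6 i = w)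
    & (forall w, near v w -> exists2 i, var s 8 <= i < var s 8 + 13 & arr s' 6 i = w)].
Proof.
move=> t64 [sn se ts sf sd sc] sv eq_es all_es es_t mv nB lB bd.
have svE : value s (Var 2) = v := sv.
rewrite apply_moveE.
have [v1 a1] := toggle_edgesP t svE eq_es.
move: (step (toggle_edges t ss) s) v1 a1 => s1 v1 a1.
have [v2 a2] : (forall x, var (step (shift_others t ss) s1) x = var s x) /\ (forall b j, arr (step (shift_others t ss) s1) b j =
   if (b == 4) && (j \in [seq val (other_end G v e) | e <- es]) then shift (kind_flag t) 1 (kind_other t) else arr s1 b j).
  have [|||h1 h2] := @shift_othersP t s1 v ss es _ _ _ all_es.
  - by move=> b i b2; rewrite a1 se //; case: b b2 => [|[|]].
  - by rewrite /= v1.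
  - by rewrite -eq_es; apply: eq_map => i; rewrite a1.
  by split=> [x|b j]; rewrite ?h1 ?v1 ?h2.
move: (step (shift_others t ss) s1) v2 a2 => s2 v2 a2.
have [v3 a3] : (forall x, var (step (shift_center t) s2) x = var s x) /\ (forall b j, arr (step (shift_center t) s2) b j =
    if (b == 4) && (j == v) then shift (kind_flag t) (kind_size t) (kind_deg t) else arr s2 b j).
  by split=> [x|b j]; rewrite /= ?v2 ?sv.
move: (step (shift_center t) s2) v3 a3 => s3 v3 a3.
have [v4 v4' a4] : [/\ (forall j, j < 4 -> var (step (update_counts t) s3) (4 + j) = degree_count G (toggle F es) j),
    (forall x, x \notin map (addn 4) (iota 0 4) -> var (step (update_counts t) s3) x = var s x) &
    (forall b j, arr (step (update_counts t) s3) b j = arr s3 b j)].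
  have [h1 h2 h3] := update_countsP t s3; split=> // [j j4|x /h2 ->]; last exact: v3.
  rewrite h1 // v3 sc //.
  by have := degree_count_toggle j mv; rewrite es_t => <-; rewrite addnK.
move: (step (update_counts t) s3) v4 v4' a4 => s4 v4 v4' a4.
have [v5 a5] := @append_logP nearby s4 isT.
move: (step (append_log nearby) s4) v5 a5 => s5 v5 a5.
rewrite -[size nearby]/13 in v5 a5.
have v48 : var s4 8 = var s 8 by apply: v4'.
rewrite v48 in v5 a5.
have se4 b i : b < 2 -> arr s4 b i = arr s0 b i.
  by move=> b2; rewrite a4 a3 a2 a1 se //; case: b b2 => [|[|]].
have ts4 : table s4 by apply: table_ext ts => i; rewrite a4 a3 a2 a1.
have sv4 : var s4 2 = v by rewrite v4'.
have [near1 near2] := value_nearby se4 ts4 sv4.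
have new_log i : var s 8 <= i < var s 8 + 13 -> nth 0 (map (value s4) nearby) (i - var s 8) \in map (value s4) nearby.
  by move=> /andP[h1 h2]; apply: mem_nth; rewrite size_map -[size nearby]/13; lia.
have enc5 : encodes s5 (toggle F es).
  split=> [|b i b2|u|e|u|j j4].
  - by rewrite v5 v4'.
  - by rewrite a5 -se4 //; case: b b2 => [|[|]].
  - by apply: table_ext ts4 u => i; rewrite a5.
  - rewrite a5 a4 a3 a2 a1 /= mem_map; last exact: val_inj.
    rewrite inE; case: ifP => [e_es|_]; last by rewrite addbF sf.
    case/and3P: mv => _ /allP/(_ e e_es)/and3P[_ /eqP-> _] _.
    by case: (kind_flag t).
  - rewrite a5 a4 a3 a2 a1 /= (degree_toggle u mv) es_t.
    case/and3P: (mv) => /eqP dv /allP all_mv _.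
    rewrite -[_ == _ :> nat]/(u == v); have [->|uv] := eqVneq u v; first by rewrite dv.
    rewrite (map_comp val) mem_map; last exact: val_inj.
    case: (boolP (u \in _)) => [/mapP[e /all_mv/and3P[_ _ /eqP <-] ->]|_] //.
    by rewrite shift0 sd.
  - by rewrite v5 v4 //; case: eqP => // j8; lia.
split=> //.
- split; [exact: enc5| |exact: v5].
  split=> [x|b i].
    rewrite v5; case: ifP => // _.
    have [/mapP[j]|xn] := boolP (x \in map (addn 4) (iota 0 4)); last by rewrite v4' //; apply bd.1.
    rewrite mem_iota => j4 ->; rewrite v4 //.
    have : degree_count G (toggle F es) j <= n by rewrite -[X in _ <= X]card_ord; apply: max_card.
    by lia.
  rewrite a5; case: ifP => [/andP[_ /new_log/near1[w ->]]|_].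
    by have := ltn_ord w; lia.
  rewrite a4 a3; case: ifP => _.
    have := kind_other_le t64; rewrite /shift /kind_size /kind_deg.
    have := ltn_pmod t./2./2 (isT : 0 < 4).
    by case: (kind_flag t); case: (odd _) => /=; lia.
  rewrite a2; case: ifP => _.
    by have := kind_other_le t64; rewrite /shift; case: (kind_flag t); lia.
  rewrite a1; case: ifP => _; last by apply bd.2.
  by case: (kind_flag t); lia.
- move=> x x9; rewrite v5; case: eqP => [E|_]; first by rewrite E in x9.
  by apply: v4'; rewrite !inE; lia.
- by move=> i il; rewrite a5 /= leqNgt il /= a4 a3 a2 a1.
- by move=> i ii; rewrite a5 /= ii; apply: near1; apply: new_log.
- move=> w /near2 wl; exists (var s 8 + index (val w) (map (value s4) nearby)).
    by have := wl; rewrite -index_mem size_map -[size nearby]/13; lia.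
  rewrite a5 /=; have := wl; rewrite -index_mem size_map -[size nearby]/13 => lt.
  by rewrite leq_addr ltn_add2l lt /= addKn nth_index.
Qed.

End Representation.

(** * The main loop *)

Lemma imbalance_ext N c c' : (forall j, j < 4 -> c j = c' j) -> imbalance N c = imbalance N c'.
Proof. by move=> h; rewrite /imbalance !h. Qed.

Lemma imbalance_le N c : (forall j, j < 4 -> c j <= N) -> imbalance N c <= 80 * N.
Proof.
move=> h; have e j : j < 4 -> dist (4 * c j) N - 4 <= 4 * N by move/h; rewrite /dist; lia.
have d : dist (4 * (c 0 + c 1)) (2 * N) <= 8 * N.
  by have := h 0 isT; have := h 1 isT; rewrite /dist; lia.
have := e 0 isT; have := e 1 isT; have := e 2 isT; have := e 3 isT.
rewrite /imbalance; lia.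
Qed.

Section MainLoop.
Variables (n k : nat) (G : multigraph 'I_n 'I_k) (s0 : state).
Hypothesis cubicG : cubic G.
Hypothesis inputG : edge_list G s0.
Implicit Types (s : state) (F : {set 'I_k}) (v : 'I_n) (e : 'I_k).

Local Notation U := (unbalance G).
Local Notation B := (n.+2 ^ 12).
Local Notation encodes := (encodes G s0).

Lemma degree_count_le F j : degree_count G F j <= n.
Proof. by rewrite -[X in _ <= X]card_ord; apply: max_card. Qed.

Lemma unbalance_le F : U F <= 80 * n.
Proof.
rewrite /unbalance card_ord; apply: imbalance_le => j _; apply: degree_count_le.
Qed.

(** The exponent 12 leaves room for factors up to 2000: [2000 <= 2 ^ 11]. *)
Lemma linear_lt a b : a <= 2000 -> b <= 2000 -> a * n + b < B.
Proof.
move=> ha hb; apply: leq_ltn_trans (_ : 2000 * n.+1 < _); first by nia.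
rewrite expnS mulnC; apply: ltn_mul => //.
apply: leq_trans (_ : 2 ^ 11 <= _); last by rewrite leq_exp2r.
by vm_compute.
Qed.

(** [log_size] bounds the length of the log: 13 new entries are paid for by a
    decrease of the potential by at least 1. *)
Record queued s F : Prop := Queued {
  log_vertex : forall i, i < var s 8 -> exists v : 'I_n, arr s 6 i = v;
  ptr_le : forall t, t < 64 -> var s (10 + t) <= var s 8;
  pending : forall t v (es : seq 'I_k), t < 64 -> size es = kind_size t ->
    is_move G F (kind_flag t) (kind_deg t) (kind_other t) v es ->
    exists2 i, var s (10 + t) <= i < var s 8 & arr s 6 i = v;
  log_size : var s 8 + 13 * U F <= n + 13 * U set0 }.

Definition loop_invariant s := exists F, [/\ encodes s F, queued s F & bounded B s].

(** A move adds 13 unread entries for each of the 64 pointers, and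
    [833 = 64 * 13 + 1]. *)
Definition weight s := imbalance (var s 0) (fun j => var s (4 + j)) * 833
  + \sum_(t < 64) (var s 8 - var s (10 + t)).

Lemma imbalance_state s F : encodes s F ->
  imbalance (var s 0) (fun j => var s (4 + j)) = U F.
Proof.
by case=> -> _ _ _ _ sc; rewrite /unbalance card_ord; apply: imbalance_ext.
Qed.

Lemma value_test_expr s F t v (es : seq 'I_k) : encodes s F ->
  size es = kind_size t -> is_move G F (kind_flag t) (kind_deg t) (kind_other t) v es ->
  (value s (test_expr t) != 0) = (var s (10 + t) < var s 8) && (U (toggle F es) < U F).
Proof.
move=> enc es_t mv; have [sn _ _ _ _ sc] := enc.
rewrite /test_expr value_conj !all_cons !value_less andbT !value_imbalance_expr.
have -> : imbalance (var s 0) (fun j => value s (Var (4 + j))) = U F by exact: imbalance_state.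
suff -> : imbalance (var s 0) (fun j => value s (new_count_expr t j)) = U (toggle F es) by [].
rewrite /unbalance card_ord sn; apply: imbalance_ext => j j4.
have := degree_count_toggle j mv; rewrite es_t => E.
by rewrite [LHS]/= sc // -E addnK.
Qed.

(** [1041 = 13 * 80 + 1], where 80 comes from [imbalance_le]. *)
Lemma log_room s F : queued s F -> var s 8 <= 1041 * n.
Proof. by case=> _ _ _; have := unbalance_le set0; lia. Qed.

Lemma near_or_far v (w : 'I_n) : near G v w \/
  [/\ w != v, (forall e, v \in ends G e -> w != other_end G v e) &
     (forall e e', v \in ends G e -> other_end G v e \in ends G e' -> w != other_end G (other_end G v e) e')].
Proof.
have [->|wv] := eqVneq w v; first by left; left.
have [/existsP[e /andP[ve /eqP we]]|no1] := boolP [exists e, (v \in ends G e) && (w == other_end G v e)].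
  by left; right; left; exists e.
have [/existsP[e /existsP[e' /and3P[ve ve' /eqP we]]]|no2] := boolP [exists e, [exists e',
   [&& v \in ends G e, other_end G v e \in ends G e' & w == other_end G (other_end G v e) e']]].
  by left; right; right; exists e, e'.
right; split=> // [e ve|e e' ve ve'].
  by apply: contra no1 => we; apply/existsP; exists e; rewrite ve.
by apply: contra no2 => we; apply/existsP; exists e; apply/existsP; exists e'; rewrite ve ve'.
Qed.

(** If the examined vertex has no move of kind [t], only the pointer of [t]
    advances.  Otherwise the potential drops, and for every kind the vertices
    whose availability may have changed are appended to the log. *)
Lemma body_invariant s : loop_invariant s -> value s guard != 0 ->
  loop_invariant (step body s) /\ weight (step body s) < weight s.
Proof.
move=> [F [enc que bd]] g0.
have [[t]|[all0 _]] := step_select test_expr process (iota 0 64) s; last first.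
  move: g0; rewrite value_sum big1_seq // => t /andP[_]; exact: all0.
rewrite mem_iota add0n -/body => /andP[_ t64] [test ->] {g0}.
have lt : var s (10 + t) < var s 8.
  by move: test; rewrite /test_expr value_conj all_cons value_less => /andP[].
have [logv ptr pend logs] := que; have [v xv] := logv _ lt.
set s1 := set_var (set_var s 2 (arr s 6 (var s (10 + t)))) (10 + t) (var s (10 + t)).+1.
have -> : step (process t) s = step (try_moves t) s1.
  by rewrite /s1 -[in RHS](addn1 (var s _)).
have sv1 : var s1 2 = v by rewrite /s1 /= xv.
have var1 x : x != 2 -> x != 10 + t -> var s1 x = var s x by rewrite /s1 /= => /negPf-> /negPf->.
have var1t : var s1 (10 + t) = (var s (10 + t)).+1 by rewrite /s1 /= eqxx.
have ptr1 t' : var s (10 + t') <= var s1 (10 + t') by rewrite /s1 /= eqn_add2l; case: eqP => // ->.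
have enc1 : encodes s1 F.
  have [sn se ts sf sd sc] := enc; split=> // j j4.
  by rewrite var1 ?sc //; lia.
have v18 : var s1 8 = var s 8 by rewrite var1.
have n_lt := linear_lt (isT : 1 <= 2000) (isT : 5 <= 2000).
have room := log_room que.
have log_lt : var s 8 + 13 < B.
  by apply: leq_ltn_trans (linear_lt (isT : 1041 <= 2000) (isT : 13 <= 2000)); lia.
have bd1 : bounded B s1.
  by apply: bounded_set_var; [apply: bounded_set_var|]; rewrite ?xv //; have := ltn_ord v; lia.
have ptr_lt1 t' : t' < 64 -> var s1 (10 + t') <= var s 8.
  by move=> t'64; rewrite /s1 /= eqn_add2l; case: eqP => _ //; apply: ptr.
have [_ _ ts1 _ _ _] := enc1.
have pend1 t' w es' : t' < 64 -> size es' = kind_size t' ->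
    is_move G F (kind_flag t') (kind_deg t') (kind_other t') w es' -> w != v \/ t != t' ->
    exists2 i, var s1 (10 + t') <= i < var s 8 & arr s 6 i = w.
  move=> t'64 es't' mv' ne; have [i /andP[i1 i2] iw] := pend _ _ _ t'64 es't' mv'.
  exists i; rewrite // i2 andbT /s1 /= eqn_add2l; case: eqP => [tt'|_] //.
  rewrite tt' in i1 ne; rewrite ltn_neqAle i1 andbT; apply/eqP => it.
  case: ne => [/eqP[]|/eqP[]] //; apply/val_inj; rewrite /= -iw -it xv //.
have [[ss ss_in [match1 ->]]|[match0 ->]] := step_select (match_expr t) (apply_move t) (slot_lists (kind_size t)) s1.
  have kt : 0 < kind_size t <= 2 by rewrite /kind_size; case: odd.
  move: ss_in; rewrite slot_listsP // => /andP[/eqP ss_t ss3].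
  have [es es_ss all_es] := edges_of_slots v ts1 ss3.
  have es_t : size es = kind_size t by have := congr1 size es_ss; rewrite !size_map ss_t.
  have mv := match1; rewrite (value_match_expr inputG t enc1 sv1 es_ss all_es) ?es_t in mv; last by case/andP: kt.
  have dec : U (toggle F es) < U F by move: test; rewrite (value_test_expr enc es_t mv) => /andP[].
  rewrite mul1n in n_lt; have := @apply_moveP _ _ _ _ inputG B s1 F t ss v es t64 enc1 sv1 es_ss all_es es_t mv n_lt _ bd1.
  rewrite v18; case=> // [[enc' bd' v8'] var' log' new' near'].
  set s' := step _ s1 in enc' bd' v8' var' log' new' near' *.
  have ptr' t' : var s' (10 + t') = var s1 (10 + t') by apply: var'.
  split.
    exists (toggle F es); split=> //; split.
    - move=> i; rewrite v8' => lti; have [lti'|gei] := ltnP i (var s 8); last by apply: new'; rewrite gei.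
      by rewrite log' //; apply: logv.
    - by move=> t' t'64; rewrite ptr' v8'; apply: leq_trans (ptr_lt1 _ t'64) (leq_addr _ _).
    - move=> t' w es' t'64 es't' mv'; rewrite ptr' v8'.
      have [/near'[i /andP[i1 i2] iw]|[wv far1 far2]] := near_or_far v w.
        by exists i => //; rewrite i2 andbT; apply: leq_trans (ptr_lt1 _ t'64) i1.
      have [i ii iw] := pend1 _ _ _ t'64 es't' (is_move_far mv wv far1 far2 mv') (or_introl wv).
      by exists i; [|rewrite log' //]; lia.
    - by rewrite v8'; lia.
  rewrite /weight (imbalance_state enc') (imbalance_state enc).
  have : \sum_(t' < 64) (var s' 8 - var s' (10 + t')) <= \sum_(t' < 64) ((var s 8 - var s (10 + t')) + 13).
    by apply: leq_sum => t' _; rewrite ptr' v8'; have := ptr1 t'; lia.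
  by rewrite big_split /= sum_nat_const card_ord; lia.
split.
  exists F; split=> //; split=> [i|t' t'64|t' w es' t'64 es't' mv'|].
  - by rewrite v18; apply: logv.
  - by rewrite v18; apply: ptr_lt1.
  - rewrite v18; suff ne : w != v \/ t != t' by exact: pend1 mv' ne.
    have [wv|] := eqVneq w v; last by left.
    right; apply/eqP => tt'; subst t' w.
    have all_es' : all (fun e => v \in ends G e) es'.
      by case/and3P: mv' => _ /allP h _; apply/allP => e /h/and3P[].
    have [ss es_ss ss3] := slots_of_edges ts1 all_es'.
    have ss_t : size ss = kind_size t by have := congr1 size es_ss; rewrite !size_map es't'.
    have kt : 0 < kind_size t <= 2 by rewrite /kind_size; case: odd.
    have := value_match_expr inputG t enc1 sv1 es_ss all_es'.
    rewrite es't' mv' match0 ?slot_listsP // ?ss_t ?eqxx ?ss3 //.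
    by case/andP: kt => _ /[swap] /[apply].
  - by rewrite v18.
rewrite /weight (imbalance_state enc1) (imbalance_state enc) ltn_add2l v18.
rewrite (bigD1 (Ordinal t64)) // [X in _ < X](bigD1 (Ordinal t64)) //.
have -> : var s1 (10 + Ordinal t64) = (var s (10 + t)).+1 by exact: var1t.
have -> : var s (10 + Ordinal t64) = var s (10 + t) by [].
rewrite -addSn; apply: leq_add; first by rewrite -subSn.
by apply: leq_sum => t' _; apply: leq_sub2l.
Qed.

End MainLoop.

(** * Preparation and running time *)

Section Preparation.
Variables (n k : nat) (G : multigraph 'I_n 'I_k) (s0 : state).
Hypothesis cubicG : cubic G.
Hypothesis inputG : edge_list G s0.
Implicit Types (s : state) (F : {set 'I_k}) (v : 'I_n) (e : 'I_k).
Local Notation B := (n.+2 ^ 12).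

Lemma toggle_nil F : toggle F [::] = F.
Proof. by apply/setP => e; rewrite !inE addbF. Qed.

(** Available moves have unread log entries, so a failing test means that the
    move does not lower the potential. *)
Lemma halted_stable s F : encodes G s0 s F -> queued G s F -> value s guard = 0 -> stable G F.
Proof.
move=> enc que g0 b j a v [|e es] es2 mv; first by rewrite toggle_nil.
have [/eqP dv /andP[/and3P[_ _ /eqP dn] _] _] := and3P mv.
have j3 : j <= 3 by rewrite -dv degree_le3.
have a3 : a <= 3 by rewrite -dn degree_le3.
have [t t64 [tb tr tj ta]] := kindP b j3 a3 (es2 : 0 < size (e :: es) <= 2).
move: mv; rewrite -tb -tj -ta => mv.
have [i /andP[i1 i2] _] := pending que t64 (esym tr) mv.
have := value_test_expr enc (esym tr) mv.
have -> : value s (test_expr t) = 0.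
  move: g0; rewrite value_sum (big_rem t); last by rewrite mem_iota.
  by move/eqP; rewrite addn_eq0 => /andP[/eqP].
by rewrite (leq_ltn_trans i1 i2) andTb => h; rewrite leqNgt -h.
Qed.

Lemma halted_quarter s F : encodes G s0 s F -> queued G s F -> value s guard = 0 ->
  quarter_degrees (spanning_subgraph G (output_edges k s)).
Proof.
move=> enc que end_s; have -> : output_edges k s = F.
  by apply/setP => e; rewrite inE (enc_flag enc); case: (e \in F).
apply: balanced_quarter => j; apply: (stable_balanced cubicG).
exact: halted_stable enc que end_s.
Qed.

Lemma ends_lt e : arr s0 0 e < n /\ arr s0 1 e < n.
Proof.
have [v ve] : exists v, v \in ends G e.
  by apply/card_gt0P; rewrite card_ends.
have := ltn_ord v; have := ltn_ord (other_end G v e).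
by case: (ends_other_input inputG ve) => -[-> ->].
Qed.

Lemma ends_neq e : arr s0 0 e != arr s0 1 e.
Proof.
have [v ve] : exists v, v \in ends G e.
  by apply/card_gt0P; rewrite card_ends.
have [_ ] := ends_other ve; rewrite -val_eqE /=.
by case: (ends_other_input inputG ve) => -[<- <-]; rewrite // eq_sym.
Qed.

Lemma edges_le : k <= 2 * n.
Proof.
have := handshake G [set: 'I_k]; under eq_bigr => v _ do rewrite /degree setTI card_star //.
rewrite sum_nat_const cardsT !card_ord; lia.
Qed.

(** The first loop keeps the slots of [v] equal to the list of the edges seen so
    far that have [v] as an end. *)
Definition adjacent (v e : nat) := (v == arr s0 0 e) || (v == arr s0 1 e).
Definition incident (i v : nat) := [seq e <- iota 0 i | adjacent v e].

Lemma size_incident v : size (incident k v) = 3.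
Proof.
rewrite -[RHS](cubicG v) /incident size_filter -val_enum_ord count_map.
rewrite -size_filter /deg -(card_uniqP (filter_uniq _ (enum_uniq _))).
by apply: eq_card => e; rewrite mem_filter mem_enum andbT [RHS]inE (ends_input inputG).
Qed.

Definition listed s (L : nat -> seq nat) := forall v : nat, v < n ->
  [/\ size (L v) <= 3, arr s 5 v = size (L v) &
      forall j, j < size (L v) -> arr s 3 (3 * v + j) = nth 0 (L v) j].

Lemma record_endP b s (v : nat) : b < 2 -> arr s b (var s 3) = v ->
  let s' := step (block (record_end b)) s in
  (forall x, var s' x = var s x) /\
  (forall a j, arr s' a j =
     if (a == 3) && (j == 3 * v + arr s 5 v) then var s 3
     else if (a == 5) && (j == v) then (arr s 5 v).+1 else arr s a j).
Proof.
move=> b2 bv; split=> // a j.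
case: b b2 bv => [|[|]] // _ bv /=; rewrite !bv addn1; by case: (eqVneq a 5) => [->|].
Qed.

Lemma record_end_bounded s s' (v i : nat) : bounded B s -> i < B -> (arr s 5 v).+1 < B ->
  (forall x, var s' x = var s x) ->
  (forall a j, arr s' a j =
     if (a == 3) && (j == 3 * v + arr s 5 v) then i
     else if (a == 5) && (j == v) then (arr s 5 v).+1 else arr s a j) ->
  bounded B s'.
Proof.
move=> [bv ba] iB aB v' a'; split=> [x|a j]; first by rewrite v'.
by rewrite a'; case: ifP => // _; case: ifP.
Qed.

Lemma record_end_listed s s' L (v i : nat) : listed s L -> v < n -> size (L v) < 3 ->
  (forall a j, arr s' a j =
     if (a == 3) && (j == 3 * v + arr s 5 v) then i
     else if (a == 5) && (j == v) then (arr s 5 v).+1 else arr s a j) ->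
  listed s' (fun w => if w == v then rcons (L w) i else L w).
Proof.
move=> ls vn sz as' w wn; have [szw aw nw] := ls w wn; have [_ av _] := ls v vn; rewrite /=.
have [wv|wv] := eqVneq w v.
  rewrite wv in szw aw nw *; rewrite ?eqxx size_rcons as' /= eqxx aw; split=> // j jle.
  move: jle; rewrite as' nth_rcons /= eqn_add2l aw ltnS leq_eqVlt => /orP[/eqP->|jlt].
    by rewrite eqxx ltnn.
  by rewrite (ltn_eqF jlt) jlt nw.
rewrite as' /= ?(negPf wv); split=> // j jlt.
rewrite as' /= av; case: eqP => [|_]; last exact: nw.
by move/eqP: wv; lia.
Qed.

Definition tabulating s := exists2 i, i <= k &
  [/\ var s 3 = i, (forall x, x != 3 -> var s x = var s0 x),
     (forall a j, a \notin [:: 3; 5] -> arr s a j = arr s0 a j),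
     listed s (incident i) & bounded B s].

Lemma incidentS i (v : nat) : incident i.+1 v = if adjacent v i then rcons (incident i v) i else incident i v.
Proof.
rewrite /incident -addn1 iotaD filter_cat /= add0n; case: ifP => _; last by rewrite cats0.
by rewrite cats1.
Qed.

Lemma tabulate_step s : tabulating s -> value s (less (Var 3) (Var 1)) != 0 ->
  tabulating (step tabulate_body s) /\
  k - var (step tabulate_body s) 3 < k - var s 3.
Proof.
case=> i ik [si sv sa sl bd]; have [sn sk _ _ _] := inputG.
rewrite value_less !valueE si sv // sk => lt_ik {ik}.
have [un wn] : arr s0 0 i < n /\ arr s0 1 i < n := ends_lt (Ordinal lt_ik).
have uw : arr s0 0 i != arr s0 1 i := ends_neq (Ordinal lt_ik).
move: un wn uw; set u := arr s0 0 i; set w := arr s0 1 i => un wn uw.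
have room (v : nat) : v < n -> adjacent v i -> size (incident i v) < 3.
  move=> vn av; have := size_incident (Ordinal vn); rewrite [nat_of_ord _]/=.
  have -> : incident k v = incident i.+1 v ++ [seq e <- iota i.+1 (k - i.+1) | adjacent v e].
    by rewrite /incident -filter_cat -(iotaD 0) subnKC.
  by rewrite size_cat incidentS av size_rcons; lia.
rewrite /tabulate_body !step_block_cat.
have [v1 a1] := @record_endP 0 s u isT ltac:(by rewrite si sa).
have l1 := record_end_listed sl un (room _ un ltac:(by rewrite /adjacent eqxx)) a1.
have iB : i < B.
  by apply: ltn_trans lt_ik _; apply: leq_ltn_trans edges_le _; have := linear_lt n (isT : 2 <= 2000) (isT : 0 <= 2000); rewrite addn0.
have small x : x < 3 -> x.+1 < B.
  by have := linear_lt n (isT : 0 <= 2000) (isT : 3 <= 2000); rewrite mul0n add0n => h x3; apply: leq_ltn_trans h.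
have ru := room _ un; rewrite /adjacent eqxx in ru.
have rw := room _ wn; rewrite /adjacent eqxx orbT in rw.
have bd1 : bounded B (step (block (record_end 0)) s).
  apply: record_end_bounded bd _ _ v1 a1; rewrite ?si //; apply: small.
  by have [_ -> _] := sl u un; apply: ru.
move: (step (block (record_end 0)) s) v1 a1 l1 bd1 => s1 v1 a1 l1 bd1.
have [v2 a2] := @record_endP 1 s1 w isT ltac:(by rewrite v1 si a1 /= sa).
have sz_w : size (if w == u then rcons (incident i w) (var s 3) else incident i w) < 3.
  by rewrite eq_sym (negPf uw); apply: rw.
have l2 := record_end_listed l1 wn sz_w a2.
have bd2 : bounded B (step (block (record_end 1)) s1).
  apply: record_end_bounded bd1 _ _ v2 a2; rewrite ?v1 ?si //; apply: small.
  by have [_ -> _] := l1 w wn.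
move: (step (block (record_end 1)) s1) v2 a2 l2 bd2 => s2 v2 a2 l2 bd2.
rewrite /= v2 v1 si addn1; split; last by lia.
exists i.+1 => //; split=> //.
- by move=> x /negPf x3; rewrite /= x3 v2 v1 sv // x3.
- move=> a j; rewrite !inE negb_or => /andP[/negPf a3 /negPf a5].
  by rewrite /= a2 a3 a5 /= a1 a3 a5 /= sa // !inE a3 a5.
- move=> v vn; have [h1 h2 h3] := l2 v vn; rewrite incidentS /adjacent -/u -/w /=.
  have E : (if w == v then rcons (if v == u then rcons (incident i v) (var s 3) else incident i v) (var s1 3)
            else if v == u then rcons (incident i v) (var s 3) else incident i v) =
           if (v == u) || (v == w) then rcons (incident i v) i else incident i v.
    rewrite v1 si eq_sym; have [->|_] := eqVneq v w; last by rewrite orbF.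
    by rewrite orbT eq_sym (negPf uw).
  by rewrite eq_sym in E; rewrite E in h1 h2 h3.
- apply: bounded_set_var => //.
  by apply: leq_ltn_trans lt_ik _; apply: leq_ltn_trans edges_le _; have := linear_lt n (isT : 2 <= 2000) (isT : 0 <= 2000); rewrite addn0.
Qed.

Lemma tabulated_table s : tabulating s -> var s 3 >= k ->
  (forall b i, b < 2 -> arr s b i = arr s0 b i) /\ table G s.
Proof.
case=> i ik [si _ sa sl _]; rewrite si => ki; have {ki ik}ik : i = k by apply/eqP; rewrite eqn_leq ik.
rewrite ik in sl; split=> [b j b2|v]; first by apply: sa; case: b b2 => [|[|]].
have [_ _ nv] := sl v (ltn_ord v); rewrite size_incident in nv.
have mem_v e : (val e \in incident k v) = (v \in ends G e).
  by rewrite mem_filter mem_iota /= add0n ltn_ord andbT (ends_input inputG).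
split=> [j j3|e].
  have : nth 0 (incident k v) j \in incident k v by rewrite mem_nth // size_incident.
  rewrite nv //; move: (nth _ _ _) => x xv.
  have xk : x < k by move: xv; rewrite mem_filter mem_iota => /and3P[].
  by exists (Ordinal xk) => //; rewrite -mem_v.
rewrite -mem_v => ev; exists (index (val e) (incident k v)); first by rewrite -(size_incident v) index_mem.
by rewrite nv ?nth_index // -(size_incident v) index_mem.
Qed.

Lemma initial_tabulating : tabulating s0.
Proof.
have [sn sk sv _ sa] := inputG; exists 0 => //; split=> //; first exact: sv.
  by move=> v vn; split=> //; apply: sa.
have lt := linear_lt n (isT : 2 <= 2000) (isT : 1 <= 2000); have := edges_le.
split=> [[|[|x]]|a j]; rewrite ?sn ?sk ?sv //; try by lia.
have [jk|kj] := ltnP j k; last by rewrite sa ?kj ?orbT //; lia.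
have [e0 e1] : arr s0 0 j < n /\ arr s0 1 j < n := ends_lt (Ordinal jk).
by case: a => [|[|a]]; rewrite ?[arr s0 a.+2 j]sa //; lia.
Qed.

Definition enqueuing s1 s := [/\ var s 8 <= n, (forall x, x != 8 -> var s x = var s1 x),
  (forall a j, a != 6 -> arr s a j = arr s1 a j),
  (forall i, i < var s 8 -> arr s 6 i = i) & bounded B s].

Lemma enqueue_step s1 s : var s1 0 = n -> enqueuing s1 s -> value s (less (Var 8) (Var 0)) != 0 ->
  enqueuing s1 (step enqueue_body s) /\ n - var (step enqueue_body s) 8 < n - var s 8.
Proof.
move=> s1n [len sv sa slog bd]; rewrite value_less !valueE [var s 0]sv // s1n => lt.
have lB := linear_lt n (isT : 1 <= 2000) (isT : 1 <= 2000).
have v8 : var (step enqueue_body s) 8 = (var s 8).+1 by rewrite /= addn1.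
rewrite v8; split; last by lia.
split; rewrite ?v8 //.
- by move=> x /negPf x8; rewrite /= x8 sv ?x8.
- by move=> a j /negPf a6; rewrite /= a6 sa ?a6.
- move=> i; rewrite /= ltnS leq_eqVlt; case: eqP => [->|_] //=; exact: slog.
- by apply: bounded_set_var; [apply: bounded_set_arr|]; rewrite //=; lia.
Qed.

Lemma degree0 v : degree G set0 v = 0.
Proof. by rewrite /degree set0I cards0. Qed.

Lemma degree_count0 j : degree_count G set0 j = (j == 0) * n.
Proof.
rewrite /degree_count; have [->|j0] := eqVneq j 0.
  rewrite mul1n -[RHS](card_ord n) -cardsT; apply: eq_card => v.
  by rewrite !inE degree0.
rewrite mul0n; apply/eqP; rewrite cards_eq0; apply/eqP/setP => v.
by rewrite !inE degree0 eq_sym (negPf j0).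
Qed.

Lemma tabulating_bounded s : tabulating s -> bounded B s.
Proof. by case=> i _ []. Qed.

Lemma enqueuing_bounded s1 s : enqueuing s1 s -> bounded B s.
Proof. by case. Qed.

Lemma loop_bounded s : loop_invariant G s0 s -> bounded B s.
Proof. by case=> F []. Qed.

Lemma tabulated_end s : tabulating s -> value s (less (Var 3) (Var 1)) = 0 ->
  [/\ k <= var s 3, var s 0 = n & enqueuing s s].
Proof.
move=> [i _ [_ sv _ _ bd]] end1; have [sn sk sv0 _ _] := inputG.
split; last by split; rewrite ?[var s 8]sv ?sv0.
  by have := value_less s (Var 3) (Var 1); rewrite end1 /= [var s 1]sv // sk => /esym/negbT; rewrite -leqNgt.
by rewrite sv.
Qed.

Lemma enqueued_end s1 s : var s1 0 = n -> enqueuing s1 s -> value s (less (Var 8) (Var 0)) = 0 ->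
  n <= var s 8.
Proof.
move=> s1n [_ sv _ _ _] end2; have s2n : var s 0 = n by rewrite sv.
by have := value_less s (Var 8) (Var 0); rewrite end2 /= s2n => /esym/negbT; rewrite -leqNgt.
Qed.

Lemma start_invariant s1 s : tabulating s1 -> k <= var s1 3 -> enqueuing s1 s -> n <= var s 8 ->
  loop_invariant G s0 (step (Assign 4 (Var 0)) s).
Proof.
move=> tab1 k1 [len sv sa slog bd] nle.
have [ends1 table1] := tabulated_table tab1 k1.
case: tab1 => i _ [_ sv1 sa1 _ _]; have [sn _ sv0 _ sa0] := inputG.
have var0 x : 1 < x -> x != 3 -> x != 8 -> var s x = 0.
  by move=> x1 x3 x8; rewrite sv // sv1 // sv0.
have arr0 a j : 1 < a -> a \notin [:: 3; 5; 6] -> arr s a j = 0.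
  rewrite !inE !negb_or => a1 /and3P[a3 a5 a6].
  by rewrite sa // sa1 ?inE ?negb_or ?a3 // sa0 // a1.
have n0 : var s 0 = n by rewrite sv // sv1.
have len_n : var s 8 = n by apply/eqP; rewrite eqn_leq len.
exists set0; split.
- split=> /= [|b j b2|v|e|v|j j4] //.
  + by rewrite sa ?ends1 //; case: b b2 => [|[|]].
  + by apply: table_ext table1 v => j; apply: sa.
  + by rewrite arr0 // inE.
  + by rewrite arr0 // degree0.
  + case: j j4 => [|j] j4; rewrite degree_count0 /= ?mul1n ?n0 //.
    by rewrite mul0n var0 //; lia.
- split=> /= [j|t t64|t v es t64 es_t mv|].
  + by rewrite len_n => jn; exists (Ordinal jn); rewrite slog ?len_n.
  + by rewrite var0 //; lia.
  + exists (val v); last by rewrite slog // len_n ltn_ord.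
    by rewrite len_n ltn_ord var0 //; lia.
  + by rewrite len_n.
- by apply: bounded_set_var => //; rewrite /= n0; have := linear_lt n (isT : 1 <= 2000) (isT : 0 <= 2000); rewrite mul1n addn0.
Qed.

Lemma start_weight s1 s : tabulating s1 -> enqueuing s1 s ->
  weight (step (Assign 4 (Var 0)) s) <= (80 * 833 + 64) * n.
Proof.
move=> [i _ [_ sv1 _ _ _]] [len sv _ _ _]; have [sn _ sv0 _ _] := inputG.
rewrite /weight mulnDl; apply: leq_add.
  rewrite mulnAC leq_mul2r; apply/orP; right.
  have n0 : var s 0 = n by rewrite sv // sv1.
  have -> : var (step (Assign 4 (Var 0)) s) 0 = n by [].
  apply: imbalance_le => -[|j] j4; first by rewrite [X in X <= _]/= n0.
  by rewrite [X in X <= _]/= sv ?sv1 ?sv0 //; lia.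
apply: leq_trans (_ : \sum_(t < 64) n <= _); last by rewrite sum_nat_const card_ord.
by apply: leq_sum => t _; apply: leq_trans (leq_subr _ _) _.
Qed.

End Preparation.

Lemma exec_block4 W c1 c2 c3 c4 s t1 s1 t2 s2 t3 s3 t4 s4 :
  exec W c1 s t1 s1 -> exec W c2 s1 t2 s2 -> exec W c3 s2 t3 s3 -> exec W c4 s3 t4 s4 ->
  exec W (block [:: c1; c2; c3; c4]) s (t1 + (t2 + (t3 + (t4 + 1)))) s4.
Proof.
move=> e1 e2 e3 e4; apply: ExecSeq e1 _; apply: ExecSeq e2 _; apply: ExecSeq e3 _.
by apply: ExecSeq e4 _; constructor.
Qed.

Lemma straight_body : straight body. Proof. by vm_compute. Qed.

(** Here [t1], [t2] and [t4] are the times of the three loops, 2 is the time of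
    the assignment between the last two, and 1 that of the final [Skip]. *)
Lemma linear_bound n k c t1 t2 t4 T1 T2 T3 w :
  k <= 2 * n -> w <= c * n ->
  t1 <= k.+1 * T1 -> t2 <= n.+1 * T2 -> t4 <= w.+1 * T3 ->
  t1 + (t2 + (2 + (t4 + 1))) <= (2 * T1 + T2 + 3 + c.+1 * T3) * n.+1.
Proof.
move=> kn wn h1 h2 h4; rewrite (mulnDl (2 * T1 + T2 + 3)) (mulnDl (2 * T1 + T2)) (mulnDl (2 * T1)).
have : t1 <= 2 * T1 * n.+1.
  by apply: leq_trans h1 _; rewrite mulnAC leq_mul2r; apply/orP; right; lia.
have : t4 <= c.+1 * T3 * n.+1.
  by apply: leq_trans h4 _; rewrite mulnAC leq_mul2r; apply/orP; right; nia.
rewrite [n.+1 * T2]mulnC in h2; move: h2.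
move: (2 * T1 * n.+1) (T2 * n.+1) (c.+1 * T3 * n.+1) => a b d; lia.
Qed.

(** The constants of the program are generalized as soon as they appear: they
    are unary numbers far too large to be computed. *)
Theorem program_linear : finds_in_linear_time program.
Proof.
have st_body := straight_body.
pose g1 := less (Var 3) (Var 1); pose g2 := less (Var 8) (Var 0).
have [S leS] : exists S, [/\ expr_growth g1 <= S, growth tabulate_body <= S, expr_growth g2 <= S
    & growth enqueue_body <= S /\ expr_growth guard <= S /\ growth body <= S].
  move: (expr_growth g1) (growth tabulate_body) (expr_growth g2) (growth enqueue_body)
    (expr_growth guard) (growth body) => a b c d e f.
  by exists (a + b + c + d + e + f); split; [| | |split; [|split]]; lia.
have [T1 T1E] : exists T, (cost g1).+1 + max_time tabulate_body = T by eexists.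
have [T2 T2E] : exists T, (cost g2).+1 + max_time enqueue_body = T by eexists.
have [T3 T3E] : exists T, (cost guard).+1 + max_time body = T by eexists.
have [c weight_le] : exists c, forall n k (G : multigraph 'I_n 'I_k) s0 s1 s, edge_list G s0 ->
    tabulating n k s0 s1 -> enqueuing n s1 s -> weight (step (Assign 4 (Var 0)) s) <= c * n.
  exists (80 * 833 + 64) => n k G s0 s1 s inputG tab enq; exact (start_weight inputG tab enq).
exists (12 * S), (2 * T1 + T2 + 3 + c.+1 * T3) => n k G s cubicG inputG.
pose B := n.+2 ^ 12; have B1 : 1 < B by rewrite /B -(exp1n 12) ltn_exp2r.
have BS : n.+2 ^ (12 * S) = B ^ S by rewrite expnM.
move: (n.+2 ^ (12 * S)) BS => W WE.
have leW g : g <= S -> B ^ g <= W by move=> gS; rewrite WE leq_exp2l.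
case: leS => /[dup] g1S /leW le1 /leW le2 /leW le3 [/leW le4 [/leW le5 /leW le6]].
have BW : B ^ expr_growth (Var 0) <= W by apply: leW; apply: leq_trans (expr_growth_gt0 g1) g1S.
have bd1 r : tabulating n k s r -> bounded B r := @tabulating_bounded n k s r.
have [t1 [s1 [ex1 tab1 end1 le_t1]]] := exec_while (W := W) (mu := fun s => k - var s 3)
  (isT : straight tabulate_body) B1 le1 le2 bd1 (tabulate_step cubicG inputG) (initial_tabulating cubicG inputG).
have h1 : t1 <= k.+1 * T1.
  by rewrite T1E in le_t1; exact: leq_trans le_t1 (leq_mul (leq_subr _ _ : (k - _).+1 <= k.+1) (leqnn T1)).
clear le_t1; have [k1 s1n enq1] := tabulated_end inputG tab1 end1.
have bd2 r : enqueuing n s1 r -> bounded B r := @enqueuing_bounded n s1 r.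
have [t2 [s2 [ex2 enq2 end2 le_t2]]] := exec_while (W := W) (mu := fun s => n - var s 8)
  (isT : straight enqueue_body) B1 le3 le4 bd2 (fun r => @enqueue_step n s1 r s1n) enq1.
have h2 : t2 <= n.+1 * T2.
  by rewrite T2E in le_t2; exact: leq_trans le_t2 (leq_mul (leq_subr _ _ : (n - _).+1 <= n.+1) (leqnn T2)).
clear le_t2; have n2 := enqueued_end s1n enq2 end2.
have [ev3 _] := eval_value B1 (bd2 _ enq2) BW.
have ex3 := @ExecAssign W 4 (Var 0) s2 _ ev3.
have inv3 := start_invariant cubicG inputG tab1 k1 enq2 n2.
have w3 := weight_le _ _ _ _ _ _ inputG tab1 enq2.
have bd4 r : loop_invariant G s r -> bounded B r := @loop_bounded n k G s r.
have [t4 [s4 [ex4 [F [enc4 que4 _]] end4 le_t4]]] := exec_while (W := W) st_body B1 le5 le6 bd4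
  (body_invariant inputG) inv3.
rewrite T3E in le_t4.
exists (t1 + (t2 + (2 + (t4 + 1)))), s4; split.
- exact: exec_block4 ex1 ex2 ex3 ex4.
- exact: linear_bound (edges_le cubicG) w3 h1 h2 le_t4.
- exact: (halted_quarter cubicG enc4 que4 end4).
Qed.

Theorem theorem1p3 :
  (forall (V E : finType) (G : multigraph V E),
     cubic G -> exists F : {set E}, quarter_degrees (spanning_subgraph G F)) /\
  (exists P : cmd, finds_in_linear_time P).
Proof.
split; last by exists program; exact: program_linear.
by move=> V E G cubicG; exact: quarter_subgraph.
Qed.
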